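(* Let $\mathfrak{g}$ be a Lie algebra over a field $k$ and $A=U(\mathfrak{g})$. Generalised left covariant differential structures $\Omega^1(U(\mathfrak{g}))$ correspond to Lie algebra $1$-cocycles $\omega\in Z^1(\mathfrak{g},\Lambda^1)$, where $\Lambda^1$ is a right $\mathfrak{g}$-module. Coboundaries correspond to inner calculi. The bimodule relations and exterior derivative are $$v\xi-\xi v=v\triangleleft\xi,\qquad \mathrm{d}\xi=\omega(\xi),\qquad\forall v\in\Lambda^1,\ \xi\in\mathfrak{g}.$$
   Context: $k$ has characteristic not $2$. A generalised first order differential calculus on an algebra $A$ is an $A$-bimodule $\Omega^1$ with a linear map $\mathrm{d}:A\to\Omega^1$ obeying the Leibniz rule (no surjectivity of $a\otimes b\mapsto a\,\mathrm{d}b$ required). For a Hopf algebra $A$ it is left covariant if equipped with a left coaction $\Delta_L:\Omega^1\to A\otimes\Omega^1$ which is a bimodule map and for which $\mathrm{d}$ is a comodule map. It is inner if there is $\theta\in\Omega^1$ with $\mathrm{d}a=\theta a-a\theta$ for all $a\in A$. Up to isomorphism a left covariant calculus has the form $\Omega^1=A\otimes\Lambda^1$ (free left module, $\Delta_L=\Delta\otimes\mathrm{id}$, right action $(a\otimes v).b=ab_{(1)}\otimes v\triangleleft b_{(2)}$ where $\Lambda^1$, the left-invariant $1$-forms, is a right $A$-module), and $\Lambda^1$ is identified with $1\otimes\Lambda^1$. A $1$-cocycle $\omega\in Z^1(\mathfrak{g},\Lambda^1)$ is a linear map $\omega:\mathfrak{g}\to\Lambda^1$ with $\omega([\xi,\eta])=\omega(\xi)\triangleleft\eta-\omega(\eta)\triangleleft\xi$;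 a coboundary is one of the form $\omega(\xi)=\theta\triangleleft\xi$ for some $\theta\in\Lambda^1$. *)

(* Defs.v *)
From HB Require Import structures.
From mathcomp Require Import all_boot all_order all_algebra.
From mathcomp Require Import boolp.

Set Implicit Arguments.
Unset Strict Implicit.
Unset Printing Implicit Defensive.

Import GRing.Theory.
Local Open Scope ring_scope.
Local Open Scope quotient_scope.

Definition bilin (k : fieldType) (U V W : lmodType k) (f : U -> V -> W) : Prop :=
  (forall v, linear (f^~ v)) /\ (forall u, linear (f u)).

Section LinearFacts.
Variable k : fieldType.

Lemma linD (U V : lmodType k) (f : U -> V) :
  linear f -> {morph f : x y / x + y}.
Proof. by move=> Hf x y; have := Hf 1 x y; rewrite !scale1r. Qed.

Lemma lin0 (U V : lmodType k) (f : U -> V) : linear f -> f 0 = 0.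
Proof. by move=> Hf; apply: (addrI (f 0)); rewrite -linD // !addr0. Qed.

Lemma linZ (U V : lmodType k) (f : U -> V) :
  linear f -> forall c x, f (c *: x) = c *: f x.
Proof. by move=> Hf c x; have := Hf c x 0; rewrite !addr0 lin0 // addr0. Qed.

Lemma linN (U V : lmodType k) (f : U -> V) : linear f -> {morph f : x / - x}.
Proof. by move=> Hf x; rewrite -scaleN1r linZ // scaleN1r. Qed.

Lemma linB (U V : lmodType k) (f : U -> V) :
  linear f -> {morph f : x y / x - y}.
Proof. by move=> Hf x y; rewrite linD // linN. Qed.

Lemma mk_lin (U V : lmodType k) (f : U -> V) :
  {morph f : x y / x + y} -> (forall c x, f (c *: x) = c *: f x) -> linear f.
Proof. by move=> HD HZ c x y; rewrite HD HZ. Qed.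

Lemma lin_sum (U V : lmodType k) (f : U -> V) I (r : seq I) (F : I -> U) :
  linear f -> f (\sum_(i <- r) F i) = \sum_(i <- r) f (F i).
Proof. by move=> Hf; apply: (big_morph f (linD Hf) (lin0 Hf)). Qed.

End LinearFacts.

(* The tensor product of V and W over k: finite formal sums of pairs (v, w),
   represented by lists, modulo the congruence that makes (v, w) bilinear. *)
Section Tensor.
Variables (k : fieldType) (V W : lmodType k).

Inductive tens_eq : seq (V * W) -> seq (V * W) -> Prop :=
| tens_eq_refl s : tens_eq s s
| tens_eq_sym s t : tens_eq s t -> tens_eq t s
| tens_eq_trans s t u : tens_eq s t -> tens_eq t u -> tens_eq s u
| tens_eq_perm s t : perm_eq s t -> tens_eq s t
| tens_eq_cat s t u : tens_eq s t -> tens_eq (s ++ u) (t ++ u)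
| tens_eq_addl v v' w : tens_eq [:: (v + v', w)] [:: (v, w); (v', w)]
| tens_eq_addr v w w' : tens_eq [:: (v, w + w')] [:: (v, w); (v, w')]
| tens_eq_scale (c : k) v w : tens_eq [:: (c *: v, w)] [:: (v, c *: w)]
| tens_eq_zero w : tens_eq [:: (0, w)] [::].

Definition tens_eqb (s t : seq (V * W)) : bool := `[< tens_eq s t >].

Lemma tens_eqb_refl : reflexive tens_eqb.
Proof. by move=> s; apply/asboolP; apply: tens_eq_refl. Qed.

Lemma tens_eqb_sym : symmetric tens_eqb.
Proof. by move=> s t; apply/asboolP/asboolP; apply: tens_eq_sym. Qed.

Lemma tens_eqb_trans : transitive tens_eqb.
Proof.
by move=> s t u /asboolP h1 /asboolP h2; apply/asboolP; apply: tens_eq_trans h2.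
Qed.

Canonical tens_equiv := EquivRel tens_eqb tens_eqb_refl tens_eqb_sym tens_eqb_trans.

Definition tens : Type := {eq_quot tens_equiv}.
HB.instance Definition _ := Choice.on tens.
HB.instance Definition _ := EqQuotient.on tens.

Definition tens_cl (s : seq (V * W)) : tens := \pi_tens s.

Lemma tens_clP s t : tens_cl s = tens_cl t <-> tens_eq s t.
Proof.
split; first by move/eqP; rewrite eqmodE => /asboolP.
by move=> h; apply/eqP; rewrite eqmodE; apply/asboolP.
Qed.

Lemma tens_cl_repr (x : tens) : tens_cl (repr x) = x.
Proof. exact: reprK. Qed.

Definition tens_scale_seq (c : k) (s : seq (V * W)) :=
  [seq (c *: p.1, p.2) | p <- s].

Definition tens0 : tens := tens_cl [::].
Definition tens_add (x y : tens) : tens := tens_cl (repr x ++ repr y).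
Definition tens_scale (c : k) (x : tens) : tens :=
  tens_cl (tens_scale_seq c (repr x)).
Definition tens_opp (x : tens) : tens := tens_scale (-1) x.

Definition pure (v : V) (w : W) : tens := tens_cl [:: (v, w)].

Lemma tens_eq_cat2 s s' t t' :
  tens_eq s s' -> tens_eq t t' -> tens_eq (s ++ t) (s' ++ t').
Proof.
move=> h1 h2; apply: (tens_eq_trans (tens_eq_cat t h1)).
apply: (@tens_eq_trans _ (t ++ s')); first by apply: tens_eq_perm; rewrite perm_catC.
apply: (@tens_eq_trans _ (t' ++ s')); first exact: tens_eq_cat.
by apply: tens_eq_perm; rewrite perm_catC.
Qed.

Lemma tens_eq_scale_seq c s t :
  tens_eq s t -> tens_eq (tens_scale_seq c s) (tens_scale_seq c t).
Proof.
rewrite /tens_scale_seq; elim => //=.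
- by move=> *; apply: tens_eq_refl.
- by move=> *; apply: tens_eq_sym.
- by move=> s1 t1 u1 _ h1 _ h2; apply: tens_eq_trans h2.
- by move=> s1 t1 h; apply: tens_eq_perm; apply: perm_map.
- by move=> s1 t1 u1 _ h; rewrite !map_cat; apply: tens_eq_cat.
- by move=> v v' w; rewrite scalerDr; apply: tens_eq_addl.
- by move=> v w w'; apply: tens_eq_addr.
- by move=> d v w; rewrite scalerA mulrC -scalerA; apply: tens_eq_scale.
- by move=> w; rewrite scaler0; apply: tens_eq_zero.
Qed.

Lemma tens_add_cl s t : tens_add (tens_cl s) (tens_cl t) = tens_cl (s ++ t).
Proof. by apply/tens_clP; apply: tens_eq_cat2; apply/tens_clP; rewrite tens_cl_repr. Qed.

Lemma tens_scale_cl c s : tens_scale c (tens_cl s) = tens_cl (tens_scale_seq c s).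
Proof. by apply/tens_clP/tens_eq_scale_seq; apply/tens_clP; rewrite tens_cl_repr. Qed.

Lemma tens_addA : associative tens_add.
Proof.
move=> x y z; rewrite -(tens_cl_repr x) -(tens_cl_repr y) -(tens_cl_repr z).
by rewrite !tens_add_cl catA.
Qed.

Lemma tens_addC : commutative tens_add.
Proof.
move=> x y; rewrite -(tens_cl_repr x) -(tens_cl_repr y) !tens_add_cl.
by apply/tens_clP/tens_eq_perm; rewrite perm_catC.
Qed.

Lemma tens_add0 : left_id tens0 tens_add.
Proof. by move=> x; rewrite -(tens_cl_repr x) tens_add_cl. Qed.

Lemma tens_scaleDl x : {morph tens_scale^~ x : a b / a + b >-> tens_add a b}.
Proof.
move=> a b; rewrite -(tens_cl_repr x) !tens_scale_cl tens_add_cl.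
elim: (repr x) => [|[v w] s IH] //=.
have -> : tens_cl ((((a + b) *: v, w)) :: tens_scale_seq (a + b) s)
  = tens_add (tens_cl [:: ((a + b) *: v, w)]) (tens_cl (tens_scale_seq (a + b) s)).
  by rewrite tens_add_cl.
rewrite IH scalerDl.
have -> : tens_cl [:: (a *: v + b *: v, w)] = tens_cl [:: (a *: v, w); (b *: v, w)].
  by apply/tens_clP; apply: tens_eq_addl.
rewrite tens_add_cl; apply/tens_clP/tens_eq_perm => /=.
by rewrite perm_cons -cat1s perm_catCA.
Qed.

Lemma tens_scale0 x : tens_scale 0 x = tens0.
Proof.
rewrite -(tens_cl_repr x) !tens_scale_cl.
elim: (repr x) => [|[v w] s IH] //=.
have -> : tens_cl (((0 *: v, w)) :: tens_scale_seq 0 s)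
  = tens_add (tens_cl [:: (0 *: v, w)]) (tens_cl (tens_scale_seq 0 s)).
  by rewrite tens_add_cl.
rewrite IH scale0r /tens0 tens_add_cl cats0.
by apply/tens_clP; apply: tens_eq_zero.
Qed.

Lemma tens_scale1 x : tens_scale 1 x = x.
Proof.
rewrite -(tens_cl_repr x) tens_scale_cl /tens_scale_seq; congr tens_cl.
by rewrite -[RHS]map_id; apply: eq_map => -[v w] /=; rewrite scale1r.
Qed.

Lemma tens_addN : left_inverse tens0 tens_opp tens_add.
Proof.
move=> x; rewrite /tens_opp -{2}(tens_scale1 x).
by rewrite -tens_scaleDl addNr tens_scale0.
Qed.

HB.instance Definition _ := GRing.isZmodule.Build tens
  tens_addA tens_addC tens_add0 tens_addN.

Lemma tens_scaleA a b x : tens_scale a (tens_scale b x) = tens_scale (a * b) x.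
Proof.
rewrite -(tens_cl_repr x) !tens_scale_cl /tens_scale_seq -map_comp.
by congr tens_cl; apply: eq_map => -[v w] /=; rewrite scalerA.
Qed.

Lemma tens_scaleDr : right_distributive tens_scale +%R.
Proof.
move=> a x y; rewrite -(tens_cl_repr x) -(tens_cl_repr y) /GRing.add /=.
by rewrite !(tens_add_cl, tens_scale_cl) /tens_scale_seq map_cat.
Qed.

HB.instance Definition _ := GRing.Zmodule_isLmodule.Build k tens
  tens_scaleA tens_scale1 tens_scaleDr tens_scaleDl.

Lemma tens_cl_cons p s : tens_cl (p :: s) = pure p.1 p.2 + tens_cl s.
Proof. by rewrite /GRing.add /= tens_add_cl; case: p. Qed.

Lemma tens_clE s : tens_cl s = \sum_(p <- s) pure p.1 p.2.
Proof. by elim: s => [|p s IH]; rewrite ?big_nil // big_cons -IH tens_cl_cons. Qed.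

Lemma tensE (x : tens) : x = \sum_(p <- repr x) pure p.1 p.2.
Proof. by rewrite -tens_clE tens_cl_repr. Qed.

Lemma pureDl w : {morph pure^~ w : v v' / v + v'}.
Proof.
by move=> v v'; rewrite {2}/GRing.add /= tens_add_cl; apply/tens_clP/tens_eq_addl.
Qed.

Lemma pureDr v : {morph pure v : w w' / w + w'}.
Proof.
by move=> w w'; rewrite {2}/GRing.add /= tens_add_cl; apply/tens_clP/tens_eq_addr.
Qed.

Lemma pureZl c v w : pure (c *: v) w = c *: pure v w.
Proof. by rewrite [RHS]tens_scale_cl. Qed.

Lemma pureZr c v w : pure v (c *: w) = c *: pure v w.
Proof. by rewrite -pureZl; apply/esym/tens_clP/tens_eq_scale. Qed.

Lemma pure_bilin : bilin pure.
Proof.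
by split=> ?; apply: mk_lin => [? ?|? ?] /=; rewrite ?(pureDl, pureDr, pureZl, pureZr).
Qed.

Lemma tens_ind (P : tens -> Prop) :
  (forall v w, P (pure v w)) -> P 0 -> (forall x y, P x -> P y -> P (x + y)) ->
  forall x, P x.
Proof.
move=> Hp H0 HD x; rewrite (tensE x).
by elim: (repr x) => [|p s IH]; rewrite ?big_nil // big_cons; apply: HD.
Qed.

Lemma tens_lin_ext (Z : lmodType k) (f h : tens -> Z) :
  linear f -> linear h -> (forall v w, f (pure v w) = h (pure v w)) -> f =1 h.
Proof.
move=> Hf Hh E; apply: tens_ind => [//||x y Ex Ey]; first by rewrite !lin0.
by rewrite !linD // Ex Ey.
Qed.

End Tensor.

(* The linear map on V (x) W induced by f; meaningful when f is bilinear. *)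
Definition tens_lift (k : fieldType) (V W Z : lmodType k) (f : V -> W -> Z)
  (x : tens V W) : Z := \sum_(p <- repr x) f p.1 p.2.

Section TensorMaps.
Variable k : fieldType.

Lemma tens_eq_lift (V W Z : lmodType k) (f : V -> W -> Z) s t :
  bilin f -> tens_eq s t ->
  \sum_(p <- s) f p.1 p.2 = \sum_(p <- t) f p.1 p.2.
Proof.
move=> [Hl Hr]; elim=> {s t} //.
- by move=> s t u _ -> _ ->.
- by move=> s t h; apply: perm_big.
- by move=> s t u _ E; rewrite !big_cat /= E.
- by move=> v v' w; rewrite !big_cons !big_nil !addr0 /= (linD (Hl w)).
- by move=> v w w'; rewrite !big_cons !big_nil !addr0 /= (linD (Hr v)).
- by move=> c v w; rewrite !big_cons !big_nil !addr0 /= (linZ (Hl w)) (linZ (Hr v)).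
- by move=> w; rewrite big_cons big_nil addr0 /= (lin0 (Hl w)).
Qed.

Lemma tens_lift_cl (V W Z : lmodType k) (f : V -> W -> Z) s : bilin f ->
  tens_lift f (tens_cl s) = \sum_(p <- s) f p.1 p.2.
Proof.
by move=> Hf; apply: tens_eq_lift => //; apply/tens_clP; rewrite tens_cl_repr.
Qed.

Lemma tens_lift_pure (V W Z : lmodType k) (f : V -> W -> Z) v w :
  bilin f -> tens_lift f (pure v w) = f v w.
Proof. by move=> Hf; rewrite tens_lift_cl // big_cons big_nil addr0. Qed.

Lemma tens_lift_linear (V W Z : lmodType k) (f : V -> W -> Z) :
  bilin f -> linear (tens_lift f).
Proof.
move=> Hf; apply: mk_lin => [x y|c x].
  rewrite -{1}(tens_cl_repr x) -{1}(tens_cl_repr y) {1}/GRing.add /= tens_add_cl.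
  by rewrite tens_lift_cl // big_cat.
rewrite -{1}(tens_cl_repr x) {1}/GRing.scale /= tens_scale_cl tens_lift_cl //.
rewrite /tens_scale_seq big_map /tens_lift scaler_sumr; apply: eq_bigr => p _ /=.
by case: Hf => Hl _; rewrite (linZ (Hl p.2)).
Qed.

Definition tens_map (V W V' W' : lmodType k) (f : V -> V') (h : W -> W') :
  tens V W -> tens V' W' :=
  tens_lift (fun v w => pure (f v) (h w)).

Definition tens_assoc (U V W : lmodType k) :
  tens (tens U V) W -> tens U (tens V W) :=
  tens_lift (fun x w => tens_lift (fun u v => pure u (pure v w)) x).

(* From f : V x V' -> V'' and h : W x W' -> W'', the operation
   (v (x) w, v' (x) w') |-> f v v' (x) h w w'. *)
Definition tens_op (V W V' W' V'' W'' : lmodType k)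
  (f : V -> V' -> V'') (h : W -> W' -> W'') (x : tens V W) (y : tens V' W') :
  tens V'' W'' :=
  tens_lift (fun v w => tens_lift (fun v' w' => pure (f v v') (h w w')) y) x.

Lemma bilin_pure_comp (V W V' W' : lmodType k) (f : V -> V') (h : W -> W') :
  linear f -> linear h -> bilin (fun v w => pure (f v) (h w)).
Proof.
move=> Hf Hh; split=> ?; apply: mk_lin => [? ?|? ?] /=.
- by rewrite (linD Hf) pureDl.
- by rewrite (linZ Hf) pureZl.
- by rewrite (linD Hh) pureDr.
- by rewrite (linZ Hh) pureZr.
Qed.

Lemma tens_map_linear (V W V' W' : lmodType k) (f : V -> V') (h : W -> W') :
  linear f -> linear h -> linear (tens_map f h).
Proof. by move=> Hf Hh; apply/tens_lift_linear/bilin_pure_comp. Qed.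

Lemma tens_map_pure (V W V' W' : lmodType k) (f : V -> V') (h : W -> W') v w :
  linear f -> linear h -> tens_map f h (pure v w) = pure (f v) (h w).
Proof. by move=> Hf Hh; rewrite /tens_map tens_lift_pure //; apply: bilin_pure_comp. Qed.

Lemma tens_assoc_bilin0 (U V W : lmodType k) (w : W) :
  bilin (fun (u : U) (v : V) => pure u (pure v w)).
Proof.
by split=> ?; apply: mk_lin => [? ?|? ?] /=; rewrite ?(pureDl, pureDr, pureZl, pureZr).
Qed.

Lemma lift_pointwise_linear (U V W Z : lmodType k) (F : W -> U -> V -> Z) x :
  (forall u v, linear (fun w => F w u v)) ->
  linear (fun w => tens_lift (F w) x).
Proof.
move=> HF c w w'; rewrite /tens_lift scaler_sumr -big_split /=.
by apply: eq_bigr => p _; rewrite HF.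
Qed.

Lemma tens_assoc_bilin (U V W : lmodType k) :
  bilin (fun (x : tens U V) (w : W) => tens_lift (fun u v => pure u (pure v w)) x).
Proof.
split=> [w|x]; first exact: tens_lift_linear (tens_assoc_bilin0 _ _ w).
apply: lift_pointwise_linear => u v.
by apply: mk_lin => [? ?|? ?] /=; rewrite ?(pureDl, pureDr, pureZl, pureZr).
Qed.

Lemma tens_assoc_linear (U V W : lmodType k) : linear (@tens_assoc U V W).
Proof. exact: tens_lift_linear (tens_assoc_bilin _ _ _). Qed.

Lemma tens_assoc_pure (U V W : lmodType k) (u : U) (v : V) (w : W) :
  tens_assoc (pure (pure u v) w) = pure u (pure v w).
Proof.
rewrite /tens_assoc tens_lift_pure; last exact: tens_assoc_bilin.
by rewrite tens_lift_pure //; apply: tens_assoc_bilin0.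
Qed.

Section Op.
Variables (V W V' W' V'' W'' : lmodType k).
Variables (f : V -> V' -> V'') (h : W -> W' -> W'').
Hypotheses (Hf : bilin f) (Hh : bilin h).

Lemma tens_op_bilin0 v w : bilin (fun v' w' => pure (f v v') (h w w')).
Proof. by apply: bilin_pure_comp; [case: Hf | case: Hh]. Qed.

Lemma tens_op_bilin1 y :
  bilin (fun v w => tens_lift (fun v' w' => pure (f v v') (h w w')) y).
Proof.
case: Hf => Hf1 _; case: Hh => Hh1 _.
split=> [w|v]; apply: lift_pointwise_linear => v' w'.
- by apply: mk_lin => [? ?|? ?] /=; rewrite ?(linD (Hf1 v')) ?(linZ (Hf1 v')) ?(pureDl, pureZl).
- by apply: mk_lin => [? ?|? ?] /=; rewrite ?(linD (Hh1 w')) ?(linZ (Hh1 w')) ?(pureDr, pureZr).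
Qed.

Lemma tens_op_bilin : bilin (tens_op f h).
Proof.
split=> [y|x]; first exact: tens_lift_linear (tens_op_bilin1 y).
move=> c y y'; rewrite /tens_op {1 3 4}/tens_lift scaler_sumr -big_split /=.
by apply: eq_bigr => p _; rewrite (tens_lift_linear (tens_op_bilin0 _ _)).
Qed.

Lemma tens_op_pure v w v' w' :
  tens_op f h (pure v w) (pure v' w') = pure (f v v') (h w w').
Proof.
rewrite /tens_op tens_lift_pure; last exact: tens_op_bilin1.
by rewrite tens_lift_pure //; apply: tens_op_bilin0.
Qed.

End Op.
End TensorMaps.

Record lieAlgebra (k : fieldType) := LieAlgebra {
  lie_space :> lmodType k;
  lie_bracket : lie_space -> lie_space -> lie_space;
  lie_bilin : bilin lie_bracket;
  lie_alt : forall x, lie_bracket x x = 0;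
  lie_jacobi : forall x y z,
    lie_bracket x (lie_bracket y z) + lie_bracket y (lie_bracket z x)
      + lie_bracket z (lie_bracket x y) = 0
}.

Notation "[ 'lie' x , y ]" := (lie_bracket x y)
  (at level 0, format "[ 'lie'  x ,  y ]") : ring_scope.

(* The universal enveloping algebra, presented as the associative unital
   k-algebra generated by the vector space g subject to xy - yx = [x, y]:
   algebraic expressions in the elements of g, modulo the congruence generated
   by the k-algebra laws, k-linearity of the generators, and that relation. *)
Section Enveloping.
Variables (k : fieldType) (g : lieAlgebra k).

Inductive env_term : Type :=
| EGen of g
| EScal of k
| EAdd of env_term & env_term
| EMul of env_term & env_term.

HB.instance Definition _ := gen_eqMixin env_term.
HB.instance Definition _ := gen_choiceMixin env_term.

Inductive env_eq : env_term -> env_term -> Prop :=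
| env_eq_refl s : env_eq s s
| env_eq_sym s t : env_eq s t -> env_eq t s
| env_eq_trans s t u : env_eq s t -> env_eq t u -> env_eq s u
| env_eq_add s s' t t' :
    env_eq s s' -> env_eq t t' -> env_eq (EAdd s t) (EAdd s' t')
| env_eq_mul s s' t t' :
    env_eq s s' -> env_eq t t' -> env_eq (EMul s t) (EMul s' t')
| env_eq_addA s t u : env_eq (EAdd s (EAdd t u)) (EAdd (EAdd s t) u)
| env_eq_addC s t : env_eq (EAdd s t) (EAdd t s)
| env_eq_add0 s : env_eq (EAdd (EScal 0) s) s
| env_eq_mulA s t u : env_eq (EMul s (EMul t u)) (EMul (EMul s t) u)
| env_eq_mul1l s : env_eq (EMul (EScal 1) s) s
| env_eq_mul1r s : env_eq (EMul s (EScal 1)) s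
| env_eq_mul0l s : env_eq (EMul (EScal 0) s) (EScal 0)
| env_eq_mulDl s t u : env_eq (EMul (EAdd s t) u) (EAdd (EMul s u) (EMul t u))
| env_eq_mulDr s t u : env_eq (EMul s (EAdd t u)) (EAdd (EMul s t) (EMul s u))
| env_eq_scalD a b : env_eq (EScal (a + b)) (EAdd (EScal a) (EScal b))
| env_eq_scalM a b : env_eq (EScal (a * b)) (EMul (EScal a) (EScal b))
| env_eq_scalC a s : env_eq (EMul (EScal a) s) (EMul s (EScal a))
| env_eq_genD x y : env_eq (EGen (x + y)) (EAdd (EGen x) (EGen y))
| env_eq_genZ a x : env_eq (EGen (a *: x)) (EMul (EScal a) (EGen x))
| env_eq_bracket x y :
    env_eq (EMul (EGen x) (EGen y)) (EAdd (EMul (EGen y) (EGen x)) (EGen [lie x, y])).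

Definition env_eqb (s t : env_term) : bool := `[< env_eq s t >].

Lemma env_eqb_refl : reflexive env_eqb.
Proof. by move=> s; apply/asboolP; apply: env_eq_refl. Qed.

Lemma env_eqb_sym : symmetric env_eqb.
Proof. by move=> s t; apply/asboolP/asboolP; apply: env_eq_sym. Qed.

Lemma env_eqb_trans : transitive env_eqb.
Proof.
by move=> s t u /asboolP h1 /asboolP h2; apply/asboolP; apply: env_eq_trans h2.
Qed.

Canonical env_equiv := EquivRel env_eqb env_eqb_refl env_eqb_sym env_eqb_trans.

Definition env : Type := {eq_quot env_equiv}.
HB.instance Definition _ := Choice.on env.
HB.instance Definition _ := EqQuotient.on env.

Definition env_cl (s : env_term) : env := \pi_env s.

Lemma env_clP s t : env_cl s = env_cl t <-> env_eq s t.
Proof.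
split; first by move/eqP; rewrite eqmodE => /asboolP.
by move=> h; apply/eqP; rewrite eqmodE; apply/asboolP.
Qed.

Lemma env_cl_repr (x : env) : env_cl (repr x) = x.
Proof. exact: reprK. Qed.

Definition env_gen (x : g) : env := env_cl (EGen x).
Definition env_scal (a : k) : env := env_cl (EScal a).
Definition env_add (x y : env) : env := env_cl (EAdd (repr x) (repr y)).
Definition env_mul (x y : env) : env := env_cl (EMul (repr x) (repr y)).

Lemma env_add_cl s t : env_add (env_cl s) (env_cl t) = env_cl (EAdd s t).
Proof. by apply/env_clP; apply: env_eq_add; apply/env_clP; rewrite env_cl_repr. Qed.

Lemma env_mul_cl s t : env_mul (env_cl s) (env_cl t) = env_cl (EMul s t).
Proof. by apply/env_clP; apply: env_eq_mul; apply/env_clP; rewrite env_cl_repr. Qed.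

Lemma env_addA : associative env_add.
Proof.
move=> x y z; rewrite -(env_cl_repr x) -(env_cl_repr y) -(env_cl_repr z).
by rewrite !env_add_cl; apply/env_clP/env_eq_addA.
Qed.

Lemma env_addC : commutative env_add.
Proof.
move=> x y; rewrite -(env_cl_repr x) -(env_cl_repr y) !env_add_cl.
exact/env_clP/env_eq_addC.
Qed.

Lemma env_add0 : left_id (env_scal 0) env_add.
Proof.
by move=> x; rewrite -(env_cl_repr x) env_add_cl; apply/env_clP/env_eq_add0.
Qed.

Lemma env_mulA : associative env_mul.
Proof.
move=> x y z; rewrite -(env_cl_repr x) -(env_cl_repr y) -(env_cl_repr z).
by rewrite !env_mul_cl; apply/env_clP/env_eq_mulA.
Qed.

Lemma env_mul1l : left_id (env_scal 1) env_mul.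
Proof.
by move=> x; rewrite -(env_cl_repr x) env_mul_cl; apply/env_clP/env_eq_mul1l.
Qed.

Lemma env_mul1r : right_id (env_scal 1) env_mul.
Proof.
by move=> x; rewrite -(env_cl_repr x) env_mul_cl; apply/env_clP/env_eq_mul1r.
Qed.

Lemma env_mul0l x : env_mul (env_scal 0) x = env_scal 0.
Proof.
by rewrite -(env_cl_repr x) env_mul_cl; apply/env_clP/env_eq_mul0l.
Qed.

Lemma env_mulDl : left_distributive env_mul env_add.
Proof.
move=> x y z; rewrite -(env_cl_repr x) -(env_cl_repr y) -(env_cl_repr z).
by rewrite !(env_mul_cl, env_add_cl); apply/env_clP/env_eq_mulDl.
Qed.

Lemma env_mulDr : right_distributive env_mul env_add.
Proof.
move=> x y z; rewrite -(env_cl_repr x) -(env_cl_repr y) -(env_cl_repr z).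
by rewrite !(env_mul_cl, env_add_cl); apply/env_clP/env_eq_mulDr.
Qed.

Lemma env_scalD a b : env_scal (a + b) = env_add (env_scal a) (env_scal b).
Proof. by rewrite env_add_cl; apply/env_clP/env_eq_scalD. Qed.

Lemma env_scalM a b : env_scal (a * b) = env_mul (env_scal a) (env_scal b).
Proof. by rewrite env_mul_cl; apply/env_clP/env_eq_scalM. Qed.

Lemma env_scalC a x : env_mul (env_scal a) x = env_mul x (env_scal a).
Proof.
by rewrite -(env_cl_repr x) !env_mul_cl; apply/env_clP/env_eq_scalC.
Qed.

Definition env_opp (x : env) : env := env_mul (env_scal (-1)) x.

Lemma env_addN : left_inverse (env_scal 0) env_opp env_add.
Proof.
move=> x; rewrite /env_opp -{2}(env_mul1l x) -env_mulDl -env_scalD addNr.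
exact: env_mul0l.
Qed.

HB.instance Definition _ := GRing.isZmodule.Build env
  env_addA env_addC env_add0 env_addN.

Section Eval.
Variables (B : lmodType k) (b1 : B) (bmul : B -> B -> B) (phi : g -> B).

Fixpoint env_eval (t : env_term) : B :=
  match t with
  | EGen x => phi x
  | EScal a => a *: b1
  | EAdd s t => env_eval s + env_eval t
  | EMul s t => bmul (env_eval s) (env_eval t)
  end.

Definition env_lift (x : env) : B := env_eval (repr x).

Hypotheses (bmulL : bilin bmul) (bmulA : associative bmul).
Hypotheses (bmul1 : left_id b1 bmul) (bmulr1 : right_id b1 bmul).
Hypotheses (phiL : linear phi).
Hypothesis phiB : forall x y, phi [lie x, y] = bmul (phi x) (phi y) - bmul (phi y) (phi x).

Lemma env_eval_eq s t : env_eq s t -> env_eval s = env_eval t.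
Proof.
case: bmulL => bL bR; elim=> {s t} //=.
- by move=> s t u _ -> _ ->.
- by move=> s s' t t' _ -> _ ->.
- by move=> s s' t t' _ -> _ ->.
- by move=> s t u; rewrite addrA.
- by move=> s t; rewrite addrC.
- by move=> s; rewrite scale0r add0r.
- by move=> s; rewrite scale1r bmul1.
- by move=> s; rewrite scale1r bmulr1.
- by move=> s; rewrite scale0r (lin0 (bL _)).
- by move=> s t u; rewrite (linD (bL _)).
- by move=> s t u; rewrite (linD (bR _)).
- by move=> a b; rewrite scalerDl.
- by move=> a b; rewrite (linZ (bL _)) (linZ (bR _)) bmul1 scalerA.
- by move=> a s; rewrite (linZ (bL _)) (linZ (bR _)) bmul1 bmulr1.
- by move=> x y; rewrite (linD phiL).
- by move=> a x; rewrite (linZ (bL _)) bmul1 (linZ phiL).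
- by move=> x y; rewrite phiB addrC subrK.
Qed.

Lemma env_lift_cl s : env_lift (env_cl s) = env_eval s.
Proof. by apply/env_eval_eq/env_clP; rewrite env_cl_repr. Qed.

Lemma env_lift_gen x : env_lift (env_gen x) = phi x.
Proof. exact: env_lift_cl. Qed.

Lemma env_lift_scal a : env_lift (env_scal a) = a *: b1.
Proof. exact: env_lift_cl. Qed.

Lemma env_lift_add x y : env_lift (x + y) = env_lift x + env_lift y.
Proof.
rewrite -(env_cl_repr x) -(env_cl_repr y) {1}/GRing.add /= env_add_cl.
by rewrite !env_lift_cl.
Qed.

Lemma env_lift_mul x y : env_lift (env_mul x y) = bmul (env_lift x) (env_lift y).
Proof.
by rewrite -(env_cl_repr x) -(env_cl_repr y) env_mul_cl !env_lift_cl.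
Qed.

End Eval.

Lemma env_one_neq0 : env_scal 1 != 0.
Proof.
pose B : lmodType k := k^o.
have bL : bilin (fun a b : B => (a : k) * b : B).
  split=> u; apply: mk_lin => [x y|c x]; rewrite ?mulrDl ?mulrDr //.
    exact/esym/mulrA.
  exact: mulrCA.
have H a : env_lift (1 : B) (fun a b : B => (a : k) * b : B) (fun _ => 0) (env_scal a)
  = a :> k.
  rewrite env_lift_scal ?/GRing.scale /= ?mulr1 //.
  - exact: mulrA.
  - exact: mul1r.
  - exact: mulr1.
  - by apply: mk_lin => [? ?|? ?]; rewrite ?addr0 ?scaler0.
  - by move=> x y; rewrite mul0r subrr.
by apply/eqP => E; have := H 1; rewrite E H => /eqP; rewrite eq_sym oner_eq0.
Qed.

HB.instance Definition _ := GRing.Zmodule_isNzRing.Build env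
  env_mulA env_mul1l env_mul1r env_mulDl env_mulDr env_one_neq0.

Definition env_scale (a : k) (x : env) : env := env_scal a * x.

Lemma env_scaleA a b x : env_scale a (env_scale b x) = env_scale (a * b) x.
Proof. by rewrite /env_scale mulrA; congr (_ * x); apply/esym/env_scalM. Qed.

Lemma env_scale1 : left_id 1 env_scale.
Proof. by move=> x; rewrite /env_scale mul1r. Qed.

Lemma env_scaleDr : right_distributive env_scale +%R.
Proof. by move=> a x y; rewrite /env_scale mulrDr. Qed.

Lemma env_scaleDl x : {morph env_scale^~ x : a b / a + b}.
Proof. by move=> a b; rewrite /env_scale [env_scal _]env_scalD mulrDl. Qed.

HB.instance Definition _ := GRing.Zmodule_isLmodule.Build k env
  env_scaleA env_scale1 env_scaleDr env_scaleDl.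

Lemma env_scaleAl (a : k) (x y : env) : a *: (x * y) = a *: x * y.
Proof. exact: mulrA. Qed.

HB.instance Definition _ := GRing.Lmodule_isLalgebra.Build k env env_scaleAl.

Lemma env_scaleAr (a : k) (x y : env) : a *: (x * y) = x * (a *: y).
Proof.
rewrite /GRing.scale /= /env_scale !mulrA; congr (_ * y).
exact: env_scalC.
Qed.

HB.instance Definition _ := GRing.Lalgebra_isAlgebra.Build k env env_scaleAr.

Lemma env_scalE a : env_scal a = a *: 1.
Proof. by rewrite [RHS]mulr1. Qed.

Lemma env_gen_linear : linear env_gen.
Proof.
apply: mk_lin => [x y|a x].
  by rewrite {2}/GRing.add /= env_add_cl; apply/env_clP/env_eq_genD.
by rewrite {2}/GRing.scale /= /env_scale [RHS]env_mul_cl; apply/env_clP/env_eq_genZ.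
Qed.

Lemma env_gen_bracket x y :
  env_gen [lie x, y] = env_gen x * env_gen y - env_gen y * env_gen x.
Proof.
apply/esym/eqP; rewrite subr_eq addrC; apply/eqP.
rewrite [LHS]env_mul_cl [env_gen y * _]env_mul_cl [RHS]env_add_cl.
exact/env_clP/env_eq_bracket.
Qed.

Lemma env_ind (P : env -> Prop) :
  (forall a, P (a *: 1)) -> (forall x, P (env_gen x)) ->
  (forall x y, P x -> P y -> P (x + y)) ->
  (forall x y, P x -> P y -> P (x * y)) -> forall x, P x.
Proof.
move=> H1 Hg HD HM x; rewrite -(env_cl_repr x).
elim: (repr x) => [y|a|s IHs t IHt|s IHs t IHt].
- exact: Hg.
- by rewrite -/(env_scal a) env_scalE.
- by rewrite -env_add_cl; apply: HD.
- by rewrite -env_mul_cl; apply: HM.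
Qed.

End Enveloping.

Record hopf_algebra (k : fieldType) := HopfAlgebra {
  hopf_alg :> algType k;
  comul : hopf_alg -> tens hopf_alg hopf_alg;
  counit : hopf_alg -> k;
  antipode : hopf_alg -> hopf_alg;
  comul_linear : linear comul;
  comul1 : comul 1 = pure 1 1;
  comulM : forall a b, comul (a * b) = tens_op *%R *%R (comul a) (comul b);
  counit_linear : scalar counit;
  counit1 : counit 1 = 1;
  counitM : forall a b, counit (a * b) = counit a * counit b;
  comulA : forall a,
    tens_assoc (tens_map comul id (comul a)) = tens_map id comul (comul a);
  comul_counitl : forall a, tens_lift (fun b c => counit b *: c) (comul a) = a;
  comul_counitr : forall a, tens_lift (fun b c => counit c *: b) (comul a) = a;
  antipode_linear : linear antipode;
  antipodel : forall a,
    tens_lift (fun b c => antipode b * c) (comul a) = counit a *: 1;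
  antipoder : forall a,
    tens_lift (fun b c => b * antipode c) (comul a) = counit a *: 1
}.

Section MoreTensor.
Variable k : fieldType.

Lemma lin_id (U : lmodType k) : linear (id : U -> U).
Proof. by []. Qed.

Lemma mul_bilin (A : algType k) : bilin (@GRing.mul A).
Proof.
split=> a; apply: mk_lin => [x y|c x] /=; rewrite ?mulrDl ?mulrDr //.
  by rewrite scalerAl.
by rewrite scalerAr.
Qed.

Lemma bilin_compl (U V W Z : lmodType k) (f : W -> Z) (m : U -> V -> W) :
  linear f -> bilin m -> bilin (fun x y => f (m x y)).
Proof.
move=> Hf [Hl Hr]; split=> u; apply: mk_lin => [x y|c x] /=.
- by rewrite (linD (Hl u)) (linD Hf).
- by rewrite (linZ (Hl u)) (linZ Hf).
- by rewrite (linD (Hr u)) (linD Hf).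
- by rewrite (linZ (Hr u)) (linZ Hf).
Qed.

Lemma bilin_compr (U V U' V' W : lmodType k) (f : U' -> U) (h : V' -> V)
  (m : U -> V -> W) :
  linear f -> linear h -> bilin m -> bilin (fun x y => m (f x) (h y)).
Proof.
move=> Hf Hh [Hl Hr]; split=> u; apply: mk_lin => [x y|c x] /=.
- by rewrite (linD Hf) (linD (Hl _)).
- by rewrite (linZ Hf) (linZ (Hl _)).
- by rewrite (linD Hh) (linD (Hr _)).
- by rewrite (linZ Hh) (linZ (Hr _)).
Qed.

Lemma lin_comp (U V W : lmodType k) (f : U -> V) (h : V -> W) :
  linear f -> linear h -> linear (fun x => h (f x)).
Proof. by move=> Hf Hh; apply: mk_lin => [x y|c x]; rewrite ?(linD Hf, linD Hh, linZ Hf, linZ Hh). Qed.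

Lemma bilin_ext (V W V' W' Z : lmodType k)
  (F G : tens V W -> tens V' W' -> Z) : bilin F -> bilin G ->
  (forall v w v' w', F (pure v w) (pure v' w') = G (pure v w) (pure v' w')) ->
  F =2 G.
Proof.
move=> [F1 F2] [G1 G2] E x y; move: x.
apply: (tens_lin_ext (F1 y) (G1 y)) => v w; move: y.
exact: (tens_lin_ext (F2 _) (G2 _)).
Qed.

Lemma tens_map_op (V W V' W' V'' W'' X Y X' Y' X'' Y'' : lmodType k)
  (m : V -> V' -> V'') (n : W -> W' -> W'')
  (m' : X -> X' -> X'') (n' : Y -> Y' -> Y'')
  (f : V -> X) (h : W -> Y) (f' : V' -> X') (h' : W' -> Y')
  (f'' : V'' -> X'') (h'' : W'' -> Y'') :
  bilin m -> bilin n -> bilin m' -> bilin n' ->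
  linear f -> linear h -> linear f' -> linear h' -> linear f'' -> linear h'' ->
  (forall v v', f'' (m v v') = m' (f v) (f' v')) ->
  (forall w w', h'' (n w w') = n' (h w) (h' w')) ->
  forall x y, tens_map f'' h'' (tens_op m n x y)
    = tens_op m' n' (tens_map f h x) (tens_map f' h' y).
Proof.
move=> Hm Hn Hm' Hn' Hf Hh Hf' Hh' Hf'' Hh'' E1 E2; apply: bilin_ext.
- by apply: bilin_compl; [apply: tens_map_linear | apply: tens_op_bilin].
- by apply: bilin_compr; try (apply: tens_map_linear => //); apply: tens_op_bilin.
- by move=> v w v' w'; rewrite tens_op_pure // !tens_map_pure // tens_op_pure // E1 E2.
Qed.

Lemma tens_assoc_op (U V W U' V' W' U'' V'' W'' : lmodType k)
  (m : U -> U' -> U'') (n : V -> V' -> V'') (p : W -> W' -> W'') :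
  bilin m -> bilin n -> bilin p -> forall x y,
  tens_assoc (tens_op (tens_op m n) p x y)
  = tens_op m (tens_op n p) (tens_assoc x) (tens_assoc y).
Proof.
move=> Hm Hn Hp; have Hmn := tens_op_bilin Hm Hn; have Hnp := tens_op_bilin Hn Hp.
have HL := @tens_assoc_linear k.
apply: bilin_ext.
- by apply: bilin_compl; [exact: HL | apply: tens_op_bilin].
- by apply: bilin_compr; [exact: HL | exact: HL | apply: tens_op_bilin].
move=> x w x' w'; rewrite tens_op_pure //; move: x x'.
have Hpl (A B : lmodType k) (b : B) : linear ((@pure k A B)^~ b).
  by case: (pure_bilin A B).
apply: bilin_ext.
- exact: (bilin_compl (lin_comp (Hpl _ _ (p w w')) (HL _ _ _)) Hmn).
- exact: (bilin_compr (lin_comp (Hpl _ _ w) (HL _ _ _))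
    (lin_comp (Hpl _ _ w') (HL _ _ _)) (tens_op_bilin Hm Hnp)).
by move=> u v u' v'; rewrite tens_op_pure // !tens_assoc_pure !tens_op_pure.
Qed.

Lemma tens_op_assoc (A B : algType k) :
  associative (tens_op (@GRing.mul A) (@GRing.mul B)).
Proof.
have HA := mul_bilin A; have HB := mul_bilin B; have [H1 H2] := tens_op_bilin HA HB.
move=> x y z; move: x y.
apply: bilin_ext.
- exact: (bilin_compr (@lin_id _) (H1 z) (conj H1 H2)).
- exact: (bilin_compl (H1 z) (conj H1 H2)).
move=> a b a' b'; move: z; apply: tens_lin_ext => [||a'' b''].
- exact: (lin_comp (H2 _) (H2 _)).
- exact: H2.
by rewrite !tens_op_pure // !mulrA.
Qed.

Lemma tens_op_1l (A B : algType k) :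
  left_id (pure 1 1) (tens_op (@GRing.mul A) (@GRing.mul B)).
Proof.
have HA := mul_bilin A; have HB := mul_bilin B; have [H1 H2] := tens_op_bilin HA HB.
apply: (tens_lin_ext (H2 _) (@lin_id _)) => a b.
by rewrite tens_op_pure // !mul1r.
Qed.

Lemma tens_op_1r (A B : algType k) :
  right_id (pure 1 1) (tens_op (@GRing.mul A) (@GRing.mul B)).
Proof.
have HA := mul_bilin A; have HB := mul_bilin B; have [H1 H2] := tens_op_bilin HA HB.
apply: (tens_lin_ext (H1 _) (@lin_id _)) => a b.
by rewrite tens_op_pure // !mulr1.
Qed.

End MoreTensor.

Lemma and4_1 (P Q R S : Prop) : [/\ P, Q, R & S] -> P. Proof. by case. Qed.
Lemma and4_2 (P Q R S : Prop) : [/\ P, Q, R & S] -> Q. Proof. by case. Qed.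
Lemma and4_3 (P Q R S : Prop) : [/\ P, Q, R & S] -> R. Proof. by case. Qed.

Lemma zmod_shuffle (V : zmodType) (p q r s u v : V) :
  p - q + (r - s) = (p + u) + (v + r) - ((q + v) + (u + s)).
Proof.
rewrite [v + r]addrC [p + u + _]addrACA [u + s]addrC [q + v + _]addrACA.
by rewrite [v + u]addrC opprD [RHS]addrACA subrr addr0 opprD addrACA.
Qed.

Section EnvHopf.
Variables (k : fieldType) (g : lieAlgebra k).
Local Notation U := (env g).
Implicit Types (a b : U) (x y : g).

Definition env_comul : U -> tens U U :=
  env_lift (pure 1 1) (tens_op *%R *%R)
    (fun x => pure (env_gen x) 1 + pure 1 (env_gen x)).

Definition env_counit : U -> k :=
  env_lift (1 : k^o) *%R (fun _ => 0).

Definition env_antipode : U -> U :=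
  env_lift (1 : U) (fun a b => b * a) (fun x => - env_gen x).

Section LiftHom.
Variables (B : lmodType k) (b1 : B) (bmul : B -> B -> B) (phi : g -> B).
Hypotheses (bmulL : bilin bmul) (bmulA : associative bmul).
Hypotheses (bmul1 : left_id b1 bmul) (bmulr1 : right_id b1 bmul).
Hypotheses (phiL : linear phi).
Hypothesis phiB : forall x y, phi [lie x, y] = bmul (phi x) (phi y) - bmul (phi y) (phi x).
Let F := env_lift b1 bmul phi.

Lemma env_lift_hom :
  [/\ linear F, F 1 = b1, {morph F : a b / a * b >-> bmul a b}
    & forall x, F (env_gen x) = phi x].
Proof.
have HM a b : F (a * b) = bmul (F a) (F b) by exact: env_lift_mul.
have Hs c : F (c *: 1) = c *: b1 by rewrite -env_scalE; apply: env_lift_scal.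
split=> //.
- apply: mk_lin => [a b|c a]; first exact: env_lift_add.
  rewrite -{1}(mul1r a) scalerAl HM Hs.
  by case: bmulL => bL _; rewrite (linZ (bL _)) bmul1.
- by rewrite -(scale1r (1 : U)) Hs scale1r.
- by move=> x; apply: env_lift_gen.
Qed.

Lemma env_lift_uniq (G : U -> B) :
  linear G -> G 1 = b1 -> {morph G : a b / a * b >-> bmul a b} ->
  (forall x, G (env_gen x) = phi x) -> G =1 F.
Proof.
case: env_lift_hom => FL F1 FM Fg GL G1 GM Gg.
apply: env_ind => [c|x|a b Ea Eb|a b Ea Eb].
- by rewrite (linZ FL) (linZ GL) F1 G1.
- by rewrite Fg Gg.
- by rewrite (linD FL) (linD GL) Ea Eb.
- by rewrite FM GM Ea Eb.
Qed.

End LiftHom.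

Local Notation mU := (mul_bilin U).
Local Notation mUU := (tens_op_bilin (mul_bilin U) (mul_bilin U)).

Lemma env_comul_hom :
  [/\ linear env_comul, env_comul 1 = pure 1 1,
      forall a b, env_comul (a * b) = tens_op *%R *%R (env_comul a) (env_comul b)
    & forall x, env_comul (env_gen x) = pure (env_gen x) 1 + pure 1 (env_gen x)].
Proof.
have gL := @env_gen_linear _ g.
apply: env_lift_hom.
- exact: mUU.
- exact: tens_op_assoc.
- exact: tens_op_1l.
- exact: tens_op_1r.
- apply: mk_lin => [x y|c x].
    by rewrite (linD gL) pureDl pureDr addrACA.
  by rewrite (linZ gL) pureZl pureZr scalerDr.
move=> x y; have [H1 H2] := mUU.
rewrite !(linD (H1 _)) !(linD (H2 _)) !tens_op_pure; try exact: mU.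
rewrite !mulr1 !mul1r env_gen_bracket.
have [P1 P2] := pure_bilin U U.
rewrite (linB (P1 1)) (linB (P2 1)) /=.
exact: zmod_shuffle.
Qed.

Lemma env_counit_hom :
  [/\ scalar env_counit, env_counit 1 = 1,
      forall a b, env_counit (a * b) = env_counit a * env_counit b
    & forall x, env_counit (env_gen x) = 0].
Proof.
have kL : bilin (fun a b : k^o => (a : k) * b : k^o).
  split=> u; apply: mk_lin => [x y|c x]; rewrite ?mulrDl ?mulrDr //.
    exact/esym/mulrA.
  exact: mulrCA.
apply: (env_lift_hom kL); [exact: mulrA | exact: mul1r | exact: mulr1 | |].
- by apply: mk_lin => [? ?|? ?]; rewrite ?addr0 ?scaler0.
- by move=> x y; rewrite mul0r subrr.
Qed.

Lemma env_antipode_hom :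
  [/\ linear env_antipode, env_antipode 1 = 1,
      forall a b, env_antipode (a * b) = env_antipode b * env_antipode a
    & forall x, env_antipode (env_gen x) = - env_gen x].
Proof.
have gL := @env_gen_linear _ g.
apply: (@env_lift_hom U 1 (fun a b => b * a)).
- by have [H1 H2] := mU; split=> u; [exact: H2 | exact: H1].
- by move=> a b c; rewrite mulrA.
- by move=> a; rewrite mulr1.
- by move=> a; rewrite mul1r.
- apply: mk_lin => [x y|c x]; first by rewrite (linD gL) opprD.
  by rewrite (linZ gL) scalerN.
- by move=> x y; rewrite env_gen_bracket opprB !mulrNN.
Qed.

Lemma env_comulA a :
  tens_assoc (tens_map env_comul id (env_comul a)) = tens_map id env_comul (env_comul a).
Proof.
have [DL D1 DM Dg] := env_comul_hom; have iL := @lin_id k U.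
have [mL mmL] := (mU, mUU).
have M1 := tens_map_linear DL iL; have M2 := tens_map_linear iL DL.
have AL := @tens_assoc_linear k U U U.
have L1 : linear (fun a => tens_assoc (tens_map env_comul id (env_comul a))).
  exact: (lin_comp DL (lin_comp M1 AL)).
have L2 : linear (fun a => tens_map id env_comul (env_comul a)) by exact: (lin_comp DL M2).
move: a; apply: env_ind => [c|x|a b Ea Eb|a b Ea Eb].
- rewrite (linZ L1) (linZ L2) D1 !tens_map_pure // D1.
  by rewrite tens_assoc_pure.
- rewrite Dg (linD M1) (linD M2) !tens_map_pure // D1 Dg (linD AL).
  have [P1 P2] := pure_bilin (tens U U) U; have [_ P4] := pure_bilin U (tens U U).
  by rewrite (linD (P1 1)) (linD (P4 1)) (linD AL) !tens_assoc_pure addrA.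
- by rewrite (linD L1) (linD L2) Ea Eb.
rewrite DM (tens_map_op (m' := tens_op *%R *%R) (n' := *%R)
  (f := env_comul) (h := id) (f' := env_comul) (h' := id)) //.
rewrite tens_assoc_op // Ea Eb.
by rewrite (tens_map_op (m' := *%R) (n' := tens_op *%R *%R)
  (f := id) (h := env_comul) (f' := id) (h' := env_comul)).
Qed.

Lemma env_counitl_bilin : bilin (fun b c : U => env_counit b *: c).
Proof.
have [eL e1 eM eg] := env_counit_hom.
split=> u; apply: mk_lin => [x y|d x] /=.
- by rewrite (linD (V := k^o) eL) scalerDl.
- by rewrite (linZ (V := k^o) eL) -scalerA.
- by rewrite scalerDr.
- by rewrite !scalerA mulrC.
Qed.

Lemma env_counitr_bilin : bilin (fun b c : U => env_counit c *: b).
Proof. by have [H1 H2] := env_counitl_bilin; split=> u; [exact: H2 | exact: H1]. Qed.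

Lemma env_counitl a : tens_lift (fun b c => env_counit b *: c) (env_comul a) = a.
Proof.
have [DL D1 DM Dg] := env_comul_hom; have [eL e1 eM eg] := env_counit_hom.
have eB := env_counitl_bilin; have FL := tens_lift_linear eB.
move: a; apply: env_ind => [c|x|a b Ea Eb|a b Ea Eb].
- by rewrite (linZ DL) (linZ FL) D1 tens_lift_pure // e1 scale1r.
- by rewrite Dg (linD FL) !tens_lift_pure // e1 eg scale1r scale0r add0r.
- by rewrite (linD DL) (linD FL) Ea Eb.
rewrite DM -[in RHS]Ea -[in RHS]Eb; move: (env_comul a) (env_comul b).
apply: bilin_ext => [||p q p' q'].
- exact: (bilin_compl FL mUU).
- exact: (bilin_compr FL FL mU).
rewrite tens_op_pure; try exact: mU.
by rewrite !tens_lift_pure // eM -scalerAl -scalerAr scalerA.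
Qed.

Lemma env_counitr a : tens_lift (fun b c => env_counit c *: b) (env_comul a) = a.
Proof.
have [DL D1 DM Dg] := env_comul_hom; have [eL e1 eM eg] := env_counit_hom.
have eB := env_counitr_bilin; have FL := tens_lift_linear eB.
move: a; apply: env_ind => [c|x|a b Ea Eb|a b Ea Eb].
- by rewrite (linZ DL) (linZ FL) D1 tens_lift_pure // e1 scale1r.
- by rewrite Dg (linD FL) !tens_lift_pure // e1 eg scale1r scale0r addr0.
- by rewrite (linD DL) (linD FL) Ea Eb.
rewrite DM -[in RHS]Ea -[in RHS]Eb; move: (env_comul a) (env_comul b).
apply: bilin_ext => [||p q p' q'].
- exact: (bilin_compl FL mUU).
- exact: (bilin_compr FL FL mU).
rewrite tens_op_pure; try exact: mU.
by rewrite !tens_lift_pure // eM -scalerAl -scalerAr scalerA.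
Qed.

Lemma env_antipodel a :
  tens_lift (fun b c => env_antipode b * c) (env_comul a) = env_counit a *: 1.
Proof.
have [DL D1 DM Dg] := env_comul_hom; have [eL e1 eM eg] := env_counit_hom.
have [SL S1 SM Sg] := env_antipode_hom; have [H1 H2] := mUU; have [M1 M2] := mU.
have FB : bilin (fun b c : U => env_antipode b * c).
  exact: (bilin_compr SL (@lin_id k U) mU).
have FL := tens_lift_linear FB.
move: a; apply: env_ind => [c|x|a b Ea Eb|a b Ea Eb].
- rewrite (linZ DL) (linZ FL) D1 tens_lift_pure // (linZ (V := k^o) eL) e1 S1 mulr1.
  by rewrite /GRing.scale /= mulr1.
- by rewrite Dg (linD FL) !tens_lift_pure // Sg S1 mul1r mulr1 addNr eg scale0r.
- by rewrite (linD DL) (linD FL) Ea Eb (linD (V := k^o) eL) scalerDl.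
rewrite DM eM -scalerA -Eb; move: (env_comul b).
apply: tens_lin_ext => [||p q].
- exact: (lin_comp (H2 _) FL).
- by apply: mk_lin => [x y|d x]; rewrite ?(linD FL) ?(linZ FL) ?scalerDr // !scalerA mulrC.
rewrite tens_lift_pure // scalerAl -(mulr1 (env_antipode p)) scalerAr -Ea.
move: (env_comul a); apply: tens_lin_ext => [||p' q'].
- exact: (lin_comp (H1 _) FL).
- exact: (lin_comp FL (lin_comp (M2 (env_antipode p)) (M1 q))).
rewrite tens_op_pure; try exact: mU.
by rewrite !tens_lift_pure // SM !mulrA.
Qed.

Lemma env_antipoder a :
  tens_lift (fun b c => b * env_antipode c) (env_comul a) = env_counit a *: 1.
Proof.
have [DL D1 DM Dg] := env_comul_hom; have [eL e1 eM eg] := env_counit_hom.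
have [SL S1 SM Sg] := env_antipode_hom; have [H1 H2] := mUU; have [M1 M2] := mU.
have FB : bilin (fun b c : U => b * env_antipode c).
  exact: (bilin_compr (@lin_id k U) SL mU).
have FL := tens_lift_linear FB.
move: a; apply: env_ind => [c|x|a b Ea Eb|a b Ea Eb].
- rewrite (linZ DL) (linZ FL) D1 tens_lift_pure // (linZ (V := k^o) eL) e1 S1 mulr1.
  by rewrite /GRing.scale /= mulr1.
- by rewrite Dg (linD FL) !tens_lift_pure // Sg S1 mul1r mulr1 addrN eg scale0r.
- by rewrite (linD DL) (linD FL) Ea Eb (linD (V := k^o) eL) scalerDl.
rewrite DM eM mulrC -scalerA -Ea; move: (env_comul a).
apply: tens_lin_ext => [||p q].
- exact: (lin_comp (H1 _) FL).
- by apply: mk_lin => [x y|d x]; rewrite ?(linD FL) ?(linZ FL) ?scalerDr // !scalerA mulrC.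
rewrite tens_lift_pure // scalerAl -{2}(mulr1 p) scalerAr -Eb.
move: (env_comul b); apply: tens_lin_ext => [||p' q'].
- exact: (lin_comp (H2 _) FL).
- exact: (lin_comp FL (lin_comp (M2 p) (M1 (env_antipode q)))).
rewrite tens_op_pure; try exact: mU.
by rewrite !tens_lift_pure // SM !mulrA.
Qed.

(* U(g) with comul x = x (x) 1 + 1 (x) x, counit x = 0, antipode x = - x on g. *)
Definition env_hopf : hopf_algebra k :=
  HopfAlgebra (and4_1 env_comul_hom) (and4_2 env_comul_hom) (and4_3 env_comul_hom)
    (and4_1 env_counit_hom) (and4_2 env_counit_hom) (and4_3 env_counit_hom)
    env_comulA env_counitl env_counitr (and4_1 env_antipode_hom)
    env_antipodel env_antipoder.

Lemma env_hopf_comul x :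
  comul (env_gen x : env_hopf) = pure (env_gen x) 1 + pure 1 (env_gen x).
Proof. by have [_ _ _ E] := env_comul_hom; apply: E. Qed.

Lemma env_hopf_counit x : counit (env_gen x : env_hopf) = 0.
Proof. by have [_ _ _ E] := env_counit_hom; apply: E. Qed.

Lemma env_hopf_antipode x : antipode (env_gen x : env_hopf) = - env_gen x.
Proof. by have [_ _ _ E] := env_antipode_hom; apply: E. Qed.

End EnvHopf.

Section Modules.
Variables (k : fieldType) (A : algType k) (M : lmodType k).

Record left_module (l : A -> M -> M) : Prop := LeftModule {
  lmod_bilin : bilin l;
  lmod1 : forall m, l 1 m = m;
  lmodM : forall a b m, l (a * b) m = l a (l b m)
}.

Record right_module (r : M -> A -> M) : Prop := RightModule {
  rmod_bilin : bilin r;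
  rmod1 : forall m, r m 1 = m;
  rmodM : forall m a b, r m (a * b) = r (r m a) b
}.

Record bimodule (l : A -> M -> M) (r : M -> A -> M) : Prop := Bimodule {
  bimod_left : left_module l;
  bimod_right : right_module r;
  bimod_comm : forall a m b, r (l a m) b = l a (r m b)
}.

End Modules.

(* Generalised first order differential calculus structures on A with the given
   space of 1-forms: surjectivity of a (x) b |-> a db is not required. *)
Record calculus (k : fieldType) (A : algType k) (Om : lmodType k) := Calculus {
  lact : A -> Om -> Om;
  ract : Om -> A -> Om;
  extd : A -> Om;
  calc_bimodule : bimodule lact ract;
  extd_linear : linear extd;
  extd_leibniz : forall a b, extd (a * b) = ract (extd a) b + lact a (extd b)
}.

Definition inner (k : fieldType) (A : algType k) (Om : lmodType k)
  (C : calculus A Om) : Prop :=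
  exists theta, forall a, extd C a = ract C theta a - lact C a theta.

(* H (x) Om is an H-bimodule through the coproduct:
   a (c (x) w) b = a_1 c b_1 (x) a_2 w b_2. *)
Record left_covariant (k : fieldType) (H : hopf_algebra k) (Om : lmodType k)
  (C : calculus H Om) (co : Om -> tens H Om) : Prop := LeftCovariant {
  co_linear : linear co;
  co_assoc : forall w,
    tens_assoc (tens_map (@comul k H) id (co w)) = tens_map id co (co w);
  co_counit : forall w, tens_lift (fun a v => counit a *: v) (co w) = w;
  co_lact : forall a w, co (lact C a w) = tens_op *%R (lact C) (comul a) (co w);
  co_ract : forall w b, co (ract C w b) = tens_op *%R (ract C) (co w) (comul b);
  co_extd : forall a, co (extd C a) = tens_map id (extd C) (comul a)
}.

Record lcov_calculus (k : fieldType) (H : hopf_algebra k) (Om : lmodType k) :=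
  LcovCalculus {
    lcov_calc :> calculus H Om;
    lcoact : Om -> tens H Om;
    lcov_covariant : left_covariant lcov_calc lcoact
  }.

Definition lcov_iso (k : fieldType) (H : hopf_algebra k) (Om Om' : lmodType k)
  (X : lcov_calculus H Om) (X' : lcov_calculus H Om') : Prop :=
  exists f : Om -> Om', linear f /\ bijective f /\
    [/\ forall a w, f (lact X a w) = lact X' a (f w),
        forall w a, f (ract X w a) = ract X' (f w) a,
        forall a, f (extd X a) = extd X' a
      & forall w, lcoact X' (f w) = tens_map id f (lcoact X w)].

(* Om = H (x) L as a free left module and a cofree left comodule, with right
   action (a (x) v).b = a b_1 (x) v.b_2 for a right H-module structure on L. *)
Definition standard_form (k : fieldType) (H : hopf_algebra k) (L : lmodType k)
  (X : lcov_calculus H (tens H L)) : Prop :=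
  [/\ forall a x, lact X a x = tens_map ( *%R a) id x,
      forall x, lcoact X x = tens_assoc (tens_map (@comul k H) id x)
    & exists2 r : L -> H -> L, right_module r &
        forall x b, ract X x b = tens_op *%R r x (comul b)].

Section LieModules.
Variables (k : fieldType) (g : lieAlgebra k).

Record right_lie_module (L : lmodType k) := RightLieModule {
  lie_act : L -> g -> L;
  lie_act_bilin : bilin lie_act;
  lie_act_bracket : forall v x y,
    lie_act v [lie x, y] = lie_act (lie_act v x) y - lie_act (lie_act v y) x
}.

Record cocycle (L : lmodType k) (M : right_lie_module L) := Cocycle {
  cocycle_fun :> g -> L;
  cocycle_linear : linear cocycle_fun;
  cocycle_bracket : forall x y,
    cocycle_fun [lie x, y] = lie_act M (cocycle_fun x) y - lie_act M (cocycle_fun y) x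
}.

Definition coboundary (L : lmodType k) (M : right_lie_module L) (w : cocycle M) : Prop :=
  exists theta, forall x, w x = lie_act M theta x.

Definition cocycle_iso (L L' : lmodType k)
  (M : right_lie_module L) (M' : right_lie_module L')
  (w : cocycle M) (w' : cocycle M') : Prop :=
  exists f : L -> L', linear f /\ bijective f /\
    (forall v x, f (lie_act M v x) = lie_act M' (f v) x) /\
    (forall x, f (w x) = w' x).

(* The bimodule relations and the exterior derivative, with L identified with
   1 (x) L and g mapped to U(g). *)
Definition realizes (L : lmodType k) (M : right_lie_module L)
  (X : lcov_calculus (env_hopf g) (tens (env_hopf g) L)) (w : cocycle M) : Prop :=
  [/\ standard_form X,
      forall v x, ract X (pure 1 v) (env_gen x) - lact X (env_gen x) (pure 1 v)
        = pure 1 (lie_act M v x)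
    & forall x, extd X (env_gen x) = pure 1 (w x)].

End LieModules.

(* Main.v *)
Require Import Defs.
From mathcomp Require Import all_boot all_algebra.
From mathcomp Require Import boolp.
From HB Require Import structures.

(* A left covariant calculus is in particular a left Hopf module, so it is free
   over its coinvariants v, the projection onto which is
   w |-> S(w_(-1)) w_(0); transporting the structure gives the standard form.
   In standard form the right action on coinvariants is recovered from the
   commutators with g, and d x is coinvariant for x in g, hence of the form
   1 (x) w(x); the Leibniz rule on [x, y] is the cocycle identity.  Conversely a
   cocycle w makes L (+) k a right g-module by (v, c).x = (v.x + c w(x), 0).  Its
   extension to U(g), applied to (0, 1), yields del : U(g) -> L with
   del(ab) = del(a).b + counit(a) del(b), and d a = a_1 (x) del(a_2).  All
   uniqueness claims hold because U(g) is generated by g. *)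

Set Implicit Arguments.
Unset Strict Implicit.
Unset Printing Implicit Defensive.
Import GRing.Theory.
Local Open Scope ring_scope.

(** * Linearity and Sweedler calculus *)

Section Linearity.
Variable k : fieldType.
Implicit Types U V W Y Z : lmodType k.

Lemma bilin_linl U V W Z (m : U -> V -> W) (h : Z -> U) v :
  bilin m -> linear h -> linear (fun x => m (h x) v).
Proof. by move=> [ml _] hL; apply: (lin_comp hL (ml v)). Qed.

Lemma bilin_linr U V W Z (m : U -> V -> W) (h : Z -> V) u :
  bilin m -> linear h -> linear (fun x => m u (h x)).
Proof. by move=> [_ mr] hL; apply: (lin_comp hL (mr u)). Qed.

Lemma lift_lin U V W Z (F : U -> V -> W) (h : Z -> tens U V) :
  bilin F -> linear h -> linear (fun x => tens_lift F (h x)).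
Proof. by move=> FB hL; apply: (lin_comp hL (tens_lift_linear FB)). Qed.

Lemma map_lin U V W Z Y (f : U -> W) (f' : V -> Y) (h : Z -> tens U V) :
  linear f -> linear f' -> linear h -> linear (fun x => tens_map f f' (h x)).
Proof. by move=> fL f'L hL; apply: (lin_comp hL (tens_map_linear fL f'L)). Qed.

Lemma scalar_scale_lin U W Z (e : U -> k) (h : Z -> U) (w : W) :
  scalar e -> linear h -> linear (fun x => e (h x) *: w).
Proof. by move=> eL hL c x y; rewrite hL eL scalerDl scalerA. Qed.

Lemma scale_lin U Z (c : k) (h : Z -> U) :
  linear h -> linear (fun x => c *: h x).
Proof. by move=> hL d x y; rewrite hL scalerDr !scalerA mulrC. Qed.

Lemma add_lin U Z (f h : Z -> U) :
  linear f -> linear h -> linear (fun x => f x + h x).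
Proof. by move=> fL hL d x y; rewrite hL fL scalerDr addrACA. Qed.

Lemma opp_lin U Z (h : Z -> U) : linear h -> linear (fun x => - h x).
Proof. by move=> hL d x y; rewrite hL opprD scalerN. Qed.

End Linearity.

Ltac use_hyp :=
  match goal with
  | H : forall _, bilin _ |- bilin _ => exact (H _)
  | H : forall _, GRing.linear_for _ _ |- GRing.linear_for _ _ => exact (H _)
  | H : forall _ _, GRing.linear_for _ _ |- GRing.linear_for _ _ => exact (H _ _)
  end.
Ltac bil :=
  first [ assumption | use_hyp | apply: pure_bilin | apply: mul_bilin
        | apply: tens_op_bilin; bil ].

(* The second-order patterns single out the argument in which the bound variable
   occurs.  Bilinearity of an operation m is only looked up (bil), never split
   into linearity of its partial applications, or the search would loop. *)
Ltac lin :=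
  cbn beta;
  lazymatch goal with
  | |- bilin _ =>
      first [ bil | split => ? ; lin ]
  | |- scalar _ => first [ assumption | apply: counit_linear ]
  | |- _ =>
    first
    [ assumption
    | use_hyp
    | apply: lin_id
    | apply: comul_linear
    | apply: antipode_linear
    | apply: tens_assoc_linear
    | match goal with
      | |- GRing.linear_for _ (fun x => (@?f x) + (@?h x)) =>
          apply: (@add_lin _ _ _ f h); lin
      | |- GRing.linear_for _ (fun x => - (@?h x)) => apply: (@opp_lin _ _ _ h); lin
      | |- GRing.linear_for _ (fun x => ?e (@?h x) *: ?w) =>
          apply: (@scalar_scale_lin _ _ _ _ e h w); lin
      | |- GRing.linear_for _ (fun x => ?c *: (@?h x)) =>
          apply: (@scale_lin _ _ _ c h); lin
      | |- GRing.linear_for _ (fun x => tens_lift ?F (@?h x)) =>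
          apply: (@lift_lin _ _ _ _ _ F h); lin
      | |- GRing.linear_for _ (fun x => tens_lift (@?F x) ?y) =>
          apply: (@lift_pointwise_linear _ _ _ _ _ F y) => ? ?; lin
      | |- GRing.linear_for _ (fun x => tens_map ?f ?f' (@?h x)) =>
          apply: (@map_lin _ _ _ _ _ _ f f' h); lin
      | |- GRing.linear_for _ (tens_map _ _) => apply: tens_map_linear; lin
      | |- GRing.linear_for _ (tens_lift _) => apply: tens_lift_linear; lin
      | |- GRing.linear_for _ (fun x => ?m (@?h x) ?y) =>
          apply: (@bilin_linl _ _ _ _ _ m h y); [bil | lin]
      | |- GRing.linear_for _ (fun x => ?m ?y (@?h x)) =>
          apply: (@bilin_linr _ _ _ _ _ m h y); [bil | lin]
      | |- GRing.linear_for _ (fun x => ?f (@?h x)) =>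
          apply: (@lin_comp _ _ _ _ h f); lin
      | |- GRing.linear_for _ (?m ?y) =>
          apply: (@bilin_linr _ _ _ _ _ m id y); [bil | lin]
      end ]
  end.

Section Sweedler.
Variable k : fieldType.

Lemma tens_map_comp (V W V' W' V'' W'' : lmodType k)
    (f : V -> V') (h : W -> W') (f' : V' -> V'') (h' : W' -> W'') x :
  linear f -> linear h -> linear f' -> linear h' ->
  tens_map f' h' (tens_map f h x) = tens_map (fun v => f' (f v)) (fun w => h' (h w)) x.
Proof.
move=> fL hL f'L h'L; move: x; apply: tens_lin_ext => [||v w]; try lin.
by rewrite !tens_map_pure //; lin.
Qed.

Lemma tens_map_id (V W : lmodType k) (x : tens V W) : tens_map id id x = x.
Proof. by move: x; apply: tens_lin_ext => [||v w]; try lin; rewrite tens_map_pure. Qed.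

Lemma tens_lift_map (V W V' W' Z : lmodType k) (f : V -> V') (h : W -> W')
    (F : V' -> W' -> Z) x :
  linear f -> linear h -> bilin F ->
  tens_lift F (tens_map f h x) = tens_lift (fun v w => F (f v) (h w)) x.
Proof.
move=> fL hL FB; have [Fl Fr] := FB.
have FB' : bilin (fun v w => F (f v) (h w)) by lin.
move: x; apply: tens_lin_ext => [||v w]; try lin.
by rewrite tens_map_pure // !tens_lift_pure.
Qed.

(** This moves a linear map inside a Sweedler sum: [tens_lift] is a finite sum over a
    representative, so linearity applies term by term. *)
Lemma comp_tens_lift (V W Z Y : lmodType k) (F : V -> W -> Z) (h : Z -> Y) x :
  linear h -> h (tens_lift F x) = tens_lift (fun v w => h (F v w)) x.
Proof. by move=> hL; rewrite /tens_lift lin_sum. Qed.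

Lemma linear_tens_lift (V W Z : lmodType k) (f : tens V W -> Z) x :
  linear f -> f x = tens_lift (fun v w => f (pure v w)) x.
Proof. by move=> fL; rewrite {1}(tensE x) lin_sum. Qed.

Lemma eq_tens_lift (V W Z : lmodType k) (F G : V -> W -> Z) x :
  F =2 G -> tens_lift F x = tens_lift G x.
Proof. by move=> E; apply: eq_bigr => p _. Qed.

Definition trilin (U V W Z : lmodType k) (T : U -> V -> W -> Z) :=
  [/\ forall v w, linear (fun u => T u v w), forall u w, linear (fun v => T u v w)
    & forall u v, linear (T u v)].

(** Iterated Sweedler sums can be regrouped: both sides are linear in [x], and on pure tensors both
    reduce to [T u v w]. *)
Lemma lift_assoc (U V W Z : lmodType k) (T : U -> V -> W -> Z) x : trilin T ->
  tens_lift (fun u y => tens_lift (fun v w => T u v w) y) (tens_assoc x) =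
  tens_lift (fun y w => tens_lift (fun u v => T u v w) y) x.
Proof.
case=> T1 T2 T3.
have B1 u : bilin (T u) by split=> *; lin.
have B2 w : bilin (fun u v => T u v w) by split=> *; lin.
move: x; apply: tens_lin_ext => [||y w]; try by lin.
rewrite [RHS]tens_lift_pure; last by lin.
move: y; apply: tens_lin_ext => [||u v]; try by lin.
rewrite tens_assoc_pure !tens_lift_pure //; lin.
Qed.

End Sweedler.

Arguments comp_tens_lift {k V W Z Y F} h {x}.

Section TensorNaturality.
Variable k : fieldType.

Lemma tens_assoc_map (U V W U' V' W' : lmodType k)
    (f : U -> U') (h : V -> V') (i : W -> W') x :
  linear f -> linear h -> linear i ->
  tens_assoc (tens_map (tens_map f h) i x) = tens_map f (tens_map h i) (tens_assoc x).
Proof.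
move=> fL hL iL; move: x; apply: tens_lin_ext => [||y w]; try lin.
rewrite tens_map_pure; try lin.
move: y; apply: tens_lin_ext => [||u v]; try lin.
by rewrite tens_map_pure // !tens_assoc_pure !tens_map_pure //; lin.
Qed.

Lemma tens_op_purer (V W V' W' V'' W'' : lmodType k)
    (m : V -> V' -> V'') (n : W -> W' -> W'') x v w :
  bilin m -> bilin n ->
  tens_op m n x (pure v w) = tens_lift (fun a b => pure (m a v) (n b w)) x.
Proof.
move=> mB nB; have B : bilin (fun a b => pure (m a v) (n b w)) by lin.
by move: x; apply: tens_lin_ext => [||a b]; try lin; rewrite tens_op_pure // tens_lift_pure.
Qed.

Lemma tens_op_purel (V W V' W' V'' W'' : lmodType k)
    (m : V -> V' -> V'') (n : W -> W' -> W'') x v w :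
  bilin m -> bilin n ->
  tens_op m n (pure v w) x = tens_lift (fun a b => pure (m v a) (n w b)) x.
Proof.
move=> mB nB; have B : bilin (fun a b => pure (m v a) (n w b)) by lin.
by move: x; apply: tens_lin_ext => [||a b]; try lin; rewrite tens_op_pure // tens_lift_pure.
Qed.

(** The operations are kept distinct so that this serves both (ab)u = a(bu) for left actions and
    v(ab) = (va)b for right actions on tensor products. *)
Lemma tens_op_opA (V1 V2 V3 V12 V23 V W1 W2 W3 W12 W23 W : lmodType k)
    (m12 : V1 -> V2 -> V12) (m : V12 -> V3 -> V) (m23 : V2 -> V3 -> V23)
    (m' : V1 -> V23 -> V)
    (n12 : W1 -> W2 -> W12) (n : W12 -> W3 -> W) (n23 : W2 -> W3 -> W23)
    (n' : W1 -> W23 -> W) x y z :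
  bilin m12 -> bilin m -> bilin m23 -> bilin m' ->
  bilin n12 -> bilin n -> bilin n23 -> bilin n' ->
  (forall a b c, m (m12 a b) c = m' a (m23 b c)) ->
  (forall a b c, n (n12 a b) c = n' a (n23 b c)) ->
  tens_op m n (tens_op m12 n12 x y) z = tens_op m' n' x (tens_op m23 n23 y z).
Proof.
move=> B1 B2 B3 B4 C1 C2 C3 C4 E F; move: x y; apply: bilin_ext; try lin.
move=> a b a' b'; move: z; apply: tens_lin_ext => [||a'' b'']; try lin.
by rewrite !tens_op_pure // E F.
Qed.

End TensorNaturality.

(** * Coassociativity and antipode identities in Sweedler form *)

Section HopfIdentities.
Variables (k : fieldType) (H : hopf_algebra k).

Section Comodule.
Variables (M Z : lmodType k) (co : M -> tens H M).
Hypotheses (coL : linear co).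
Hypothesis coA : forall w,
  tens_assoc (tens_map (@comul k H) id (co w)) = tens_map id co (co w).

(** Both sides are the sum of T(w_(-2), w_(-1), w_(0)). Allowing any comodule covers [comul] itself
    as well as the coaction on forms. *)
Lemma coassoc_lift (T : H -> H -> M -> Z) w : trilin T ->
  tens_lift (fun a u => tens_lift (fun b c => T b c u) (comul a)) (co w) =
  tens_lift (fun a u => tens_lift (fun b v => T a b v) (co u)) (co w).
Proof.
move=> TT; have [T1 T2 T3] := TT.
rewrite -(tens_lift_map (F := fun y u => tens_lift (fun b c => T b c u) y)); try lin.
rewrite -lift_assoc // coA tens_lift_map //; try lin.
Qed.

End Comodule.

Let dL := @comul_linear k H.
Let sL := @antipode_linear k H.
Local Notation "x ** y" := (tens_op *%R *%R x y) (at level 40).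

(** The left side is a_1 (x) a_2 S(a_3); after regrouping, the antipode gives counit(a_2) and the
    counit law absorbs it. *)
Lemma comul_antipoder (a : H) :
  tens_lift (fun b c => comul b ** pure 1 (antipode c)) (comul a) = pure a 1.
Proof.
under eq_tens_lift => b c.
  rewrite tens_op_purer; try exact: mul_bilin.
  under eq_tens_lift do rewrite mulr1.
  over.
rewrite (coassoc_lift (T := fun b c d => pure b (c * antipode d)) dL (@comulA k H)); last first.
  by split=> *; lin.
under eq_tens_lift => b c.
  rewrite -(comp_tens_lift (pure b)); last by lin.
  rewrite antipoder pureZr -pureZl.
  over.
rewrite -(comp_tens_lift (fun b => pure b 1)); last by lin.
by rewrite comul_counitr.
Qed.

(* In Sweedler's notation S(a_1)_1 a_2 (x) S(a_1)_2 a_3 = counit(a) 1 (x) 1;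
   multiply on the right by 1 (x) S(a_4). *)
Lemma comul_antipodel (a : H) :
  tens_lift (fun b c => comul (antipode b) ** pure c 1) (comul a) = pure 1 (antipode a).
Proof.
(* Writing c (x) 1 as c_1 (x) c_2 S(c_3) brings in S(a_4) and puts S(a_1) a_2 under a single
   coproduct, where the antipode axiom applies. *)
under eq_tens_lift => b c.
  rewrite -(comul_antipoder c) comp_tens_lift; last by lin.
  under eq_tens_lift => c1 d do rewrite tens_op_assoc -comulM.
  over.
rewrite -(coassoc_lift (T := fun b c d => comul (antipode b * c) ** pure 1 (antipode d))
   dL (@comulA k H)); last by split=> *; lin.
under eq_tens_lift => y d.
  rewrite -(comp_tens_lift (fun z => comul z ** pure 1 (antipode d))); last by lin.
  rewrite antipodel (linZ dL) comul1.
  rewrite (linZ (f := fun z => z ** pure 1 (antipode d))); last by lin.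
  rewrite tens_op_1l.
  over.
rewrite -{2}(comul_counitl a) (comp_tens_lift (fun z => pure 1 (antipode z))); last by lin.
apply: eq_tens_lift => b c.
by rewrite (linZ sL) pureZr.
Qed.

End HopfIdentities.

(** * Hopf modules *)

Section Transport.
Variables (k : fieldType) (H : hopf_algebra k) (Om Om' : lmodType k).
Variables (X : lcov_calculus H Om) (f : Om -> Om') (h : Om' -> Om).
Hypotheses (fL : linear f) (hL : linear h) (fK : cancel f h) (hK : cancel h f).

Lemma lcov_transport : exists X' : lcov_calculus H Om',
  [/\ forall a x, lact X' a x = f (lact X a (h x)),
      forall x b, ract X' x b = f (ract X (h x) b),
      forall a, extd X' a = f (extd X a)
    & forall x, lcoact X' x = tens_map id f (lcoact X (h x))].
Proof.
have [[lB l1 lM] [rB r1 rM] lr] := calc_bimodule X.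
have [coL coA coE coLa coRa coD] := lcov_covariant X.
have [dL dM] := (extd_linear X, extd_leibniz X).
pose l a x := f (lact X a (h x)); pose r x b := f (ract X (h x) b).
have [lB' rB'] : bilin l /\ bilin r by split; split=> *; rewrite /l /r; lin.
have B : bimodule l r.
  split; last by move=> a m b; rewrite /l /r !fK lr.
    split=> [|m|a b m]; rewrite /l ?l1 ?hK ?lM ?fK //.
  split=> [|m|m a b]; rewrite /r ?r1 ?hK ?rM ?fK //.
have DL : linear (fun a => f (extd X a)) by lin.
have DM a b : f (extd X (a * b)) = r (f (extd X a)) b + l a (f (extd X b)).
  by rewrite dM (linD fL) /l /r !fK.
pose co x := tens_map id f (lcoact X (h x)).
(* The identity of H (x) H is written as a tensor product of maps, the form in which naturality of
   the associator applies. *)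
have fI : tens_map id f = tens_map (tens_map id id) f :> (tens (tens H H) Om -> _).
  by congr (tens_map _ f); apply/funext => x; rewrite tens_map_id.
have C : left_covariant (Calculus B DL DM) co.
  split=> /=.
  - by rewrite /co; lin.
  - move=> w; rewrite /co !tens_map_comp //; try lin.
    rewrite -(tens_map_comp (f := @comul k H) (h := id) (f' := id) (h' := f)); try lin.
    rewrite fI tens_assoc_map; try lin.
    rewrite coA tens_map_comp; try lin.
    by congr (tens_map id _ _); apply/funext => u; rewrite /co fK.
  - move=> w; rewrite /co tens_lift_map; try lin.
    under eq_tens_lift do rewrite -(linZ fL).
    by rewrite -comp_tens_lift // coE hK.
  - move=> a w; rewrite /co fK coLa -[in RHS](tens_map_id (comul a)).
    by apply: tens_map_op => //=; try lin; move=> *; rewrite /l fK.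
  - move=> w b; rewrite /co fK coRa -[in RHS](tens_map_id (comul b)).
    by apply: tens_map_op => //=; try lin; move=> *; rewrite /r fK.
  - by move=> a; rewrite /co fK coD tens_map_comp; try lin.
by exists (LcovCalculus C); split.
Qed.

End Transport.

(** * The fundamental theorem of Hopf modules *)

Section HopfModule.
Variables (k : fieldType) (H : hopf_algebra k) (Om : lmodType k).
Variable X : lcov_calculus H Om.

Local Notation co := (lcoact X).
Local Notation l := (lact X).
Local Notation S := (@antipode k H).
Let coL : linear co := co_linear (lcov_covariant X).
Let lB : bilin l := lmod_bilin (bimod_left (calc_bimodule X)).

(** Made boolean by classical reflection, so that the coinvariants form a subtype inheriting the
    structure of a vector space. *)
Definition coinv : {pred Om} := fun w => `[< lcoact X w = pure 1 w >].

Lemma coinv_submod_closed : submod_closed coinv.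
Proof.
split=> [|c u v /asboolP Eu /asboolP Ev]; apply/asboolP.
  by rewrite (lin0 coL) (lin0 (f := pure 1)) //; lin.
by rewrite coL Eu Ev pureDr pureZr.
Qed.

HB.instance Definition _ :=
  GRing.isSubmodClosed.Build k Om coinv coinv_submod_closed.

Definition coinv_form := {w : Om | w \in coinv}.
HB.instance Definition _ := [isSub of coinv_form for @sval _ _].
HB.instance Definition _ := [Choice of coinv_form by <:].
HB.instance Definition _ := [SubChoice_isSubLmodule of coinv_form by <:].

Lemma coinv_formP (v : coinv_form) : co (val v) = pure 1 (val v).
Proof. exact/asboolP/(valP v). Qed.

Definition coinv_part (w : Om) : Om := tens_lift (fun a u => l (S a) u) (co w).

Lemma coinv_part_lin : linear coinv_part.
Proof. by rewrite /coinv_part; lin. Qed.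

(** The coaction gives S(w_(-2))_1 w_(-1) (x) S(w_(-2))_2 w_(0) after coassociativity, and
    [comul_antipodel] collapses this to 1 (x) S(w_(-1)) w_(0). *)
Lemma coinv_part_coinv w : coinv_part w \in coinv.
Proof.
have [_ coA _ coLa _ _] := lcov_covariant X.
have mB := mul_bilin H.
have opA (x y : tens H H) (z : tens H Om) :
    tens_op *%R l (tens_op *%R *%R x y) z =
    tens_op *%R l x (tens_op *%R l y z).
  apply: tens_op_opA => // *; first by rewrite mulrA.
  by rewrite (lmodM (bimod_left (calc_bimodule X))).
have pure_split (c : H) u : pure c u = tens_op *%R l (pure c 1) (pure 1 u).
  by rewrite tens_op_pure // mulr1 (lmod1 (bimod_left (calc_bimodule X))).
apply/asboolP; rewrite /coinv_part comp_tens_lift //.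
under eq_tens_lift => a u.
  rewrite coLa linear_tens_lift; last by lin.
  over.
rewrite -(coassoc_lift (T := fun a b v => tens_op *%R l (comul (S a)) (pure b v)) coL coA);
  last by split=> *; lin.
rewrite comp_tens_lift; last by lin.
apply: eq_tens_lift => a u.
rewrite (eq_tens_lift _ (G := fun b c =>
  tens_op *%R l (tens_op *%R *%R (comul (S b)) (pure c 1)) (pure 1 u))); last first.
  by move=> b c; rewrite pure_split opA.
rewrite -(comp_tens_lift (fun y => tens_op *%R l y (pure 1 u))); last by lin.
by rewrite comul_antipodel tens_op_pure // mulr1.
Qed.

(** For coinvariant v the coaction of av is a_1 (x) a_2 v, so the projection is S(a_1) a_2 v. *)
Lemma coinv_part_lact a v : v \in coinv -> coinv_part (l a v) = counit a *: v.
Proof.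
have [_ _ _ coLa _ _] := lcov_covariant X.
have [_ l1 lM] := bimod_left (calc_bimodule X).
have mB := mul_bilin H; have [ll _] := lB.
move=> /asboolP Ev; rewrite /coinv_part coLa Ev tens_op_purer //.
rewrite (comp_tens_lift (tens_lift (fun a u => l (S a) u))); last by lin.
rewrite (eq_tens_lift _ (G := fun b c => l (S b * c) v)); last first.
  by move=> b c; rewrite tens_lift_pure ?mulr1 ?lM //; lin.
by rewrite -(comp_tens_lift (fun y => l y v)) // antipodel (linZ (ll v)) l1.
Qed.

Lemma coinv_part_id v : v \in coinv -> coinv_part v = v.
Proof.
move=> Ev; rewrite -{1}(lmod1 (bimod_left (calc_bimodule X)) v).
by rewrite coinv_part_lact // counit1 scale1r.
Qed.

(** This is w_(-2) S(w_(-1)) w_(0) = w; hence the coinvariants generate [Om] as a left module. *)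
Lemma coinv_decomp w : tens_lift (fun a u => l a (coinv_part u)) (co w) = w.
Proof.
have [_ coA coE _ _ _] := lcov_covariant X.
have [_ l1 lM] := bimod_left (calc_bimodule X); have [ll lr] := lB.
rewrite (eq_tens_lift _ (G := fun a u => tens_lift (fun b v => l (a * S b) v) (co u))).
  rewrite -(coassoc_lift (T := fun a b v => l (a * S b) v) coL coA); last by split=> *; lin.
  rewrite -[RHS]coE; apply: eq_tens_lift => a u.
  by rewrite -(comp_tens_lift (fun y => l y u)) // antipoder (linZ (ll u)) l1.
move=> a u; rewrite /coinv_part (comp_tens_lift (l a)) //.
by apply: eq_tens_lift => b v; rewrite lM.
Qed.

(** By [coinv_decomp], w is a sum of terms bu with u coinvariant; then a(bu) = (ab)u and the counit
    is multiplicative. *)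
Lemma coinv_part_lactE a w : coinv_part (l a w) = counit a *: coinv_part w.
Proof.
have pL := coinv_part_lin; have [_ l1 lM] := bimod_left (calc_bimodule X).
rewrite -{1 2}(coinv_decomp w) (comp_tens_lift (fun w => coinv_part (l a w))); last by lin.
rewrite (comp_tens_lift (fun w => counit a *: coinv_part w)); last by lin.
apply: eq_tens_lift => b u.
by rewrite -lM !coinv_part_lact ?coinv_part_coinv // counitM scalerA.
Qed.

(** Decompose w into terms au with u coinvariant: (au)b = a(ub), and the projection turns a into
    counit(a). This makes v, b |-> projection of vb associative as an action on coinvariants. *)
Lemma coinv_part_ract w b : coinv_part (ract X (coinv_part w) b) = coinv_part (ract X w b).
Proof.
have pL := coinv_part_lin; have [_ _ coE _ _ _] := lcov_covariant X.
have [rB _ _] := bimod_right (calc_bimodule X).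
rewrite -{2}(coinv_decomp w) -{1}(coE w).
rewrite (comp_tens_lift (fun w => coinv_part (ract X (coinv_part w) b))); last by lin.
rewrite [RHS](comp_tens_lift (fun w => coinv_part (ract X w b))); last by lin.
apply: eq_tens_lift => a u.
rewrite (bimod_comm (calc_bimodule X)) coinv_part_lactE.
by rewrite (linZ (f := fun w => coinv_part (ract X (coinv_part w) b))) //; lin.
Qed.

Definition to_coinv (w : Om) : coinv_form := exist _ (coinv_part w) (coinv_part_coinv w).

Lemma to_coinv_lin : linear to_coinv.
Proof. by move=> c x y; apply/val_inj; rewrite /= coinv_part_lin. Qed.

Lemma coinv_val_lin : linear (val : coinv_form -> Om).
Proof. by []. Qed.

Lemma to_coinvK : cancel val to_coinv.
Proof. by move=> v; apply/val_inj; rewrite /= coinv_part_id // (valP v). Qed.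

(** The multiplication map of the fundamental theorem of Hopf modules; [to_free] below is its
    inverse w |-> w_(-1) (x) P(w_(0)), with P the projection onto coinvariants. *)
Definition free_of (x : tens H coinv_form) : Om := tens_lift (fun a v => l a (val v)) x.

Definition to_free (w : Om) : tens H coinv_form := tens_map id to_coinv (co w).

Lemma free_of_pure a v : free_of (pure a v) = l a (val v).
Proof. by have vL := coinv_val_lin; rewrite /free_of tens_lift_pure //; lin. Qed.

Lemma free_of_lin : linear free_of.
Proof. by have vL := coinv_val_lin; rewrite /free_of; lin. Qed.

Lemma to_free_lin : linear to_free.
Proof. by have tL := to_coinv_lin; rewrite /to_free; lin. Qed.

Lemma co_lact_val a (v : coinv_form) :
  co (l a (val v)) = tens_lift (fun b c => pure b (free_of (pure c v))) (comul a).
Proof.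
have [_ _ _ coLa _ _] := lcov_covariant X; have mB := mul_bilin H.
rewrite coLa coinv_formP tens_op_purer //; apply: eq_tens_lift => b c.
by rewrite mulr1 free_of_pure.
Qed.

(** The coaction of av is a_1 (x) a_2 v, and a_2 v projects to counit(a_2) v, so the result is a_1
    counit(a_2) (x) v. *)
Lemma free_ofK : cancel free_of to_free.
Proof.
have [[tL vL] fL] := (to_coinv_lin, coinv_val_lin, free_of_lin); have iL := @lin_id k H.
apply: (tens_lin_ext (f := fun x => to_free (free_of x)) (h := id)) => [||a v].
- by rewrite /to_free; lin.
- exact: lin_id.
rewrite /to_free {1}free_of_pure co_lact_val (comp_tens_lift (tens_map id to_coinv)); last by lin.
rewrite (eq_tens_lift _ (G := fun b c => pure (counit c *: b) v)).
  rewrite -(comp_tens_lift (fun b => pure b v)); last by lin.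
  by rewrite comul_counitr.
move=> b c; rewrite tens_map_pure // free_of_pure pureZl -pureZr; congr pure.
by apply/val_inj; rewrite /= coinv_part_lact // (valP v).
Qed.

Lemma to_freeK : cancel to_free free_of.
Proof.
have [tL vL] := (to_coinv_lin, coinv_val_lin).
by move=> w; rewrite /free_of /to_free tens_lift_map ?coinv_decomp //; lin.
Qed.

Lemma free_of_lact a x : free_of (tens_map ( *%R a) id x) = l a (free_of x).
Proof.
have [fL iL] := (free_of_lin, @lin_id k coinv_form).
have aL : linear ( *%R a) by lin.
have [_ _ lM] := bimod_left (calc_bimodule X).
move: x; apply: tens_lin_ext => [||b v]; try by lin.
by rewrite tens_map_pure // !free_of_pure lM.
Qed.

Lemma lcov_standard_form :
  exists2 X' : lcov_calculus H (tens H coinv_form), standard_form X' & lcov_iso X X'.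
Proof.
have [[[tL vL] fL] gL] := (to_coinv_lin, coinv_val_lin, free_of_lin, to_free_lin).
have [_ _ _ _ coRa _] := lcov_covariant X.
have [rB r1 rM] := bimod_right (calc_bimodule X).
have mB := mul_bilin H.
have [X' [E1 E2 E3 E4]] := lcov_transport X gL fL to_freeK free_ofK.
have actE a w : to_free (l a w) = tens_map ( *%R a) id (to_free w).
  by rewrite -{1}(to_freeK w) -free_of_lact free_ofK.
exists X'; last first.
  exists to_free; split=> //; split; first by exists free_of; [exact: to_freeK | exact: free_ofK].
  by split=> *; rewrite ?E1 ?E2 ?E3 ?E4 ?to_freeK.
split.
- by move=> a x; rewrite E1 actE free_ofK.
- move=> x; rewrite E4; move: x; apply: tens_lin_ext => [||a v]; try by lin.
  rewrite free_of_pure co_lact_val tens_map_pure; try by lin.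
  rewrite (linear_tens_lift (f := fun y => tens_assoc (pure y v))); last by lin.
  rewrite (comp_tens_lift (tens_map id to_free)); last by lin.
  apply: eq_tens_lift => b c; rewrite tens_assoc_pure tens_map_pure; try by lin.
  by rewrite free_ofK.
(* On coinvariants this is the adjoint action v.b = S(b_1) v b_2, since the coaction of vb is b_1
   (x) v b_2. *)
pose r (v : coinv_form) b := to_coinv (ract X (val v) b).
have rB' : bilin r by rewrite /r; lin.
exists r.
  split=> // [v|v a b]; rewrite /r ?r1 ?to_coinvK //.
  by apply/val_inj; rewrite /= coinv_part_ract rM.
move=> x b; rewrite E2; move: x; apply: tens_lin_ext => [||a v]; try by lin.
rewrite free_of_pure (bimod_comm (calc_bimodule X)) actE /to_free coRa coinv_formP.
rewrite !tens_op_purel // !comp_tens_lift; try by lin.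
apply: eq_tens_lift => c d; rewrite !tens_map_pure ?mul1r //; lin.
Qed.

End HopfModule.

(** * Calculi in standard form *)

Section StandardCalculus.
Variables (k : fieldType) (H : hopf_algebra k) (L : lmodType k).
Variables (r : L -> H -> L) (del : H -> L).
Hypotheses (rP : right_module r) (delL : linear del).
Hypothesis delM : forall a b, del (a * b) = r (del a) b + counit a *: del b.

Let l (a : H) (x : tens H L) := tens_map ( *%R a) id x.
Let ra (x : tens H L) (b : H) := tens_op *%R r x (comul b).
Let co (x : tens H L) := tens_assoc (tens_map (@comul k H) id x).
Let d (a : H) := tens_map id del (comul a).

Let mB := mul_bilin H.
Let rB := rmod_bilin rP.
Let mbL (a : H) : linear ( *%R a). Proof. by lin. Qed.

Lemma standard_lact_bilin : bilin l.
Proof. by rewrite /l /tens_map; split=> *; lin. Qed.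

Lemma standard_ract_bilin : bilin ra.
Proof. by rewrite /ra; split=> *; lin. Qed.

Lemma standard_bimodule : bimodule l ra.
Proof.
have [_ r1 rM] := rP.
split.
- split=> [|x|a b x]; first exact: standard_lact_bilin.
    by rewrite /l -[RHS](tens_map_id x); congr (tens_map _ _ _); apply/funext => a; rewrite mul1r.
  rewrite /l tens_map_comp //; try by lin.
  by congr (tens_map _ _ _); apply/funext => c; rewrite mulrA.
- split=> [|x|x a b]; first exact: standard_ract_bilin.
    rewrite /ra comul1; move: x; apply: tens_lin_ext => [||a v]; try by lin.
    by rewrite tens_op_pure // mulr1 r1.
  by rewrite /ra comulM; symmetry; apply: tens_op_opA => // c e f; rewrite mulrA.
- move=> a x b; rewrite /ra /l; move: x; apply: tens_lin_ext => [||c v]; try by lin.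
  rewrite tens_map_pure // !tens_op_purel // comp_tens_lift; last by lin.
  by apply: eq_tens_lift => e f; rewrite tens_map_pure // mulrA.
Qed.

Lemma standard_extd_lin : linear d.
Proof. by rewrite /d; lin. Qed.

(** Expanding a_1 b_1 (x) del(a_2 b_2) by the twisted Leibniz rule of [del] gives a_1 b_1 (x)
    del(a_2).b_2 and a_1 counit(a_2) b_1 (x) del(b_2). *)
Lemma standard_extdM a b : d (a * b) = ra (d a) b + l a (d b).
Proof.
have eB : bilin (fun (e : H) (v : L) => counit e *: v) by lin.
(* With a replaced by a_1 counit(a_2), every term is bilinear in [comul a] and [comul b], and pure
   tensors suffice. *)
have {1}-> : l a (d b) = tens_op *%R (fun e v => counit e *: v) (comul a) (d b).
  rewrite -{1}(comul_counitr a) /l /d; move: (comul a) (comul b); apply: bilin_ext.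
  - rewrite /tens_map; split=> *; lin.
  - split=> *; lin.
  move=> e f e' f'; rewrite (tens_lift_pure (f := fun b c => counit c *: b)); last by lin.
  by rewrite !tens_map_pure // tens_op_pure // -scalerAl pureZl pureZr.
rewrite /d /ra comulM; move: (comul a) (comul b); apply: bilin_ext.
- split=> *; lin.
- split=> *; lin.
move=> e f e' f'; rewrite !tens_op_pure // !tens_map_pure // !tens_op_pure //; try by lin.
by rewrite delM pureDr.
Qed.

Lemma standard_left_covariant :
  left_covariant (Calculus standard_bimodule standard_extd_lin standard_extdM) co.
Proof.
have dL := @comul_linear k H; have coL : linear co by rewrite /co; lin.
have mmB := tens_op_bilin mB mB.
have co_pure a v : co (pure a v) = tens_lift (fun b c => pure b (pure c v)) (comul a).
  rewrite /co tens_map_pure; try by lin.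
  rewrite (linear_tens_lift (f := fun y => tens_assoc (pure y v))); last by lin.
  by apply: eq_tens_lift => b c; rewrite tens_assoc_pure.
split=> //=.
- apply: tens_lin_ext => [||a v]; try by lin.
  rewrite co_pure !comp_tens_lift; try by lin.
  (* Both sides equal a_1 (x) a_2 (x) a_3 (x) v. *)
  transitivity (tens_lift (fun b c =>
      tens_lift (fun e f => pure e (pure f (pure c v))) (comul b)) (comul a)).
    apply: eq_tens_lift => b c; rewrite tens_map_pure; try by lin.
    rewrite (linear_tens_lift (f := fun y => tens_assoc (pure y _))); last by lin.
    by apply: eq_tens_lift => e f; rewrite tens_assoc_pure.
  rewrite (coassoc_lift (T := fun b c e => pure b (pure c (pure e v))) dL (@comulA k H)).
    by apply: eq_tens_lift => b c; rewrite tens_map_pure ?co_pure ?comp_tens_lift //; lin.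
  by split=> *; lin.
- apply: tens_lin_ext => [||a v]; try by lin.
  rewrite co_pure comp_tens_lift; last by lin.
  rewrite (eq_tens_lift _ (G := fun b c => pure (counit b *: c) v)).
    by rewrite -(comp_tens_lift (fun b => pure b v)) ?comul_counitl //; lin.
  by move=> b c; rewrite tens_lift_pure ?pureZl //; lin.
- have lB := standard_lact_bilin.
  move=> a; rewrite /l; apply: tens_lin_ext => [||b v]; try by lin.
  rewrite tens_map_pure // !co_pure comulM.
  move: (comul a) (comul b); apply: bilin_ext; try by split=> *; lin.
  move=> e f e' f'; rewrite tens_op_pure // !tens_lift_pure ?tens_op_pure //; try by lin.
  by rewrite /l tens_map_pure.
- have raB := standard_ract_bilin.
  move=> x b.
  rewrite {1}/ra /co (tens_map_op (m' := tens_op *%R *%R) (n' := r)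
    (f := @comul k H) (h := id) (f' := @comul k H) (h' := id)) //; last exact: comulM.
  rewrite tens_assoc_op // comulA; move: (tens_assoc _) (comul b).
  apply: bilin_ext; try by split=> *; lin.
  by move=> *; rewrite tens_map_pure // !tens_op_pure //; lin.
move=> a; rewrite /co /d.
(* Inserting the identity of H (x) H lets the associator pass [del]; coassociativity then gives a_1
   (x) a_2 (x) del(a_3) on both sides. *)
have -> : tens_map (@comul k H) id (tens_map id del (comul a)) =
    tens_map (tens_map id id) del (tens_map (@comul k H) id (comul a)).
  rewrite !tens_map_comp; try by lin.
  by congr (tens_map _ _ _); apply/funext => b; rewrite tens_map_id.
rewrite tens_assoc_map ?comulA; try by lin.
by rewrite tens_map_comp; try by lin.
Qed.

Lemma standard_calculus : exists X : lcov_calculus H (tens H L),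
  [/\ standard_form X, forall x b, ract X x b = tens_op *%R r x (comul b)
    & forall a, extd X a = tens_map id del (comul a)].
Proof. by exists (LcovCalculus standard_left_covariant); split=> //; split=> //; exists r. Qed.

End StandardCalculus.

(** * Modules and derivations of the enveloping algebra *)

Section EnvAction.
Variables (k : fieldType) (g : lieAlgebra k) (L : lmodType k) (M : right_lie_module g L).

(** In a product the left factor acts first, as a right action demands. *)
Fixpoint term_act (t : env_term g) (v : L) : L :=
  match t with
  | EGen x => lie_act M v x
  | EScal a => a *: v
  | EAdd s t => term_act s v + term_act t v
  | EMul s t => term_act t (term_act s v)
  end.

Lemma term_act_lin t : linear (term_act t).
Proof.
have aB := lie_act_bilin M; elim: t => [x|a|s IHs t IHt|s IHs t IHt] /=; lin.
Qed.

(** The bracket relation of U(g) is [lie_act_bracket]; the algebra laws hold because terms act by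
    linear maps under reversed composition. *)
Lemma term_act_eq s t : env_eq s t -> term_act s =1 term_act t.
Proof.
have [aL aR] := lie_act_bilin M; have tL := term_act_lin.
elim=> {s t} /=.
- by [].
- by move=> s t _ E v; rewrite E.
- by move=> s t u _ E1 _ E2 v; rewrite E1.
- by move=> s s' t t' _ E1 _ E2 v; rewrite E1 E2.
- by move=> s s' t t' _ E1 _ E2 v; rewrite E1 E2.
- by move=> s t u v; rewrite addrA.
- by move=> s t v; rewrite addrC.
- by move=> s v; rewrite scale0r add0r.
- by [].
- by move=> s v; rewrite scale1r.
- by move=> s v; rewrite scale1r.
- by move=> s v; rewrite !scale0r (lin0 (tL s)).
- by move=> s t u v; rewrite (linD (tL u)).
- by [].
- by move=> a b v; rewrite scalerDl.
- by move=> a b v; rewrite scalerA mulrC.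
- by move=> a s v; rewrite (linZ (tL s)).
- by move=> x y v; rewrite (linD (aR v)).
- by move=> a x v; rewrite (linZ (aR v)) (linZ (aL x)).
- by move=> x y v; rewrite lie_act_bracket addrC subrK.
Qed.

Definition env_act (v : L) (a : env g) : L := term_act (repr a) v.

Lemma env_act_cl v t : env_act v (env_cl t) = term_act t v.
Proof. by apply: term_act_eq; apply/env_clP; rewrite env_cl_repr. Qed.

Lemma env_actD v a b : env_act v (a + b) = env_act v a + env_act v b.
Proof. by rewrite [a + b]/(env_add a b) env_act_cl. Qed.

Lemma env_actM v a b : env_act v (a * b) = env_act (env_act v a) b.
Proof. by rewrite [a * b]/(env_mul a b) env_act_cl. Qed.

Lemma env_act_gen v x : env_act v (env_gen x) = lie_act M v x.
Proof. exact: env_act_cl. Qed.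

Lemma env_act_right_module : right_module env_act.
Proof.
have tL := term_act_lin.
split; last exact: env_actM.
  split=> [a|v]; first exact: tL.
  apply: mk_lin => [a b|c a]; first exact: env_actD.
  by rewrite [c *: a]/(env_scal g c * a) env_actM env_act_cl /=; apply: linZ.
by move=> v; rewrite [1]/(env_scal g 1) env_act_cl /= scale1r.
Qed.

End EnvAction.

(** * Maps on U(g) determined by their values on g *)

Section EnvUniqueness.
Variables (k : fieldType) (g : lieAlgebra k).

(** Induction on [a] with [v] varying, since in a product the second factor acts on [r v a]. *)
Lemma env_intertwine (L L' : lmodType k) (r : L -> env g -> L) (r' : L' -> env g -> L')
    (f : L -> L') : right_module r -> right_module r' -> linear f ->
  (forall v x, f (r v (env_gen x)) = r' (f v) (env_gen x)) ->
  forall v a, f (r v a) = r' (f v) a.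
Proof.
move=> [[_ rL] r1 rM] [[_ r'L] r'1 r'M] fL E v a; move: a v; apply: env_ind => //.
- by move=> c v; rewrite (linZ (rL v)) (linZ (r'L _)) (linZ fL) r1 r'1.
- by move=> a b Ea Eb v; rewrite (linD (rL v)) (linD (r'L _)) (linD fL) Ea Eb.
- by move=> a b Ea Eb v; rewrite rM r'M Eb Ea.
Qed.

Lemma derivation1 (A : algType k) (Om : lmodType k) (l : A -> Om -> Om) (r : Om -> A -> Om)
    (d : A -> Om) : bimodule l r ->
  (forall a b, d (a * b) = r (d a) b + l a (d b)) -> d 1 = 0.
Proof.
move=> [[_ l1 _] [_ r1 _] _] dM; apply: (addrI (d 1)).
by rewrite addr0 -{3}(mulr1 1) dM r1 l1.
Qed.

(** Both derivations vanish on scalars by [derivation1], and the Leibniz rule propagates agreement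
    from g to products. *)
Lemma env_derivation_ext (Om : lmodType k) (l : env g -> Om -> Om) (r : Om -> env g -> Om)
    (d d' : env g -> Om) : bimodule l r -> linear d -> linear d' ->
  (forall a b, d (a * b) = r (d a) b + l a (d b)) ->
  (forall a b, d' (a * b) = r (d' a) b + l a (d' b)) ->
  (forall x, d (env_gen x) = d' (env_gen x)) -> d =1 d'.
Proof.
move=> B dL d'L dM d'M E; apply: env_ind => //.
- by move=> c; rewrite (linZ dL) (linZ d'L) !(derivation1 B).
- by move=> a b Ea Eb; rewrite (linD dL) (linD d'L) Ea Eb.
- by move=> a b Ea Eb; rewrite dM d'M Ea Eb.
Qed.

End EnvUniqueness.

(** * Extending a cocycle from g to U(g) *)

Section CocycleExtension.
Variables (k : fieldType) (g : lieAlgebra k) (L : lmodType k).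
Variables (M : right_lie_module g L) (w : cocycle M).
Local Notation Lk := (L * k^o)%type.

(** The extension of the trivial module k by L attached to the cocycle. *)
Definition ext_act (p : Lk) (x : g) : Lk := (lie_act M p.1 x + (p.2 : k) *: w x, 0).

Lemma ext_act_bilin : bilin ext_act.
Proof.
have [aL aR] := lie_act_bilin M; have wL := cocycle_linear w.
split=> [x|p] c u v; congr pair; rewrite /= ?scaler0 ?addr0 //.
  by rewrite aL scalerDl scalerDr scalerA addrACA.
by rewrite aR wL !scalerDr addrACA !scalerA mulrC.
Qed.

(** In the first component the coefficient of [p.2] is precisely the cocycle identity; the second
    component is zero. *)
Lemma ext_act_bracket p x y :
  ext_act p [lie x, y] = ext_act (ext_act p x) y - ext_act (ext_act p y) x.
Proof.
have [aL _] := lie_act_bilin M.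
rewrite /ext_act /= !scale0r !addr0; congr pair; last by rewrite /= subr0.
rewrite /= lie_act_bracket cocycle_bracket !(linD (aL _)) !(linZ (aL _)).
by rewrite scalerBr opprD addrACA.
Qed.

Definition ext_module := RightLieModule ext_act_bilin ext_act_bracket.

Definition cocycle_ext (a : env g) : L := (env_act ext_module (0, 1) a).1.

(** The inclusion of L commutes with the action of g, hence with that of U(g). *)
Lemma ext_act_fst v a : env_act ext_module (v, 0) a = (env_act M v a, 0).
Proof.
have iL : linear (fun v : L => (v, 0) : Lk) by move=> c u u'; congr pair; rewrite /= scaler0 addr0.
rewrite -(env_intertwine (env_act_right_module M) (env_act_right_module ext_module) iL) //.
by move=> u x; rewrite !env_act_gen /= /ext_act /= scale0r addr0.
Qed.

(** The quotient by L is the trivial module, on which U(g) acts through the counit. *)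
Lemma ext_act_snd p a : (env_act ext_module p a).2 = p.2 * env_counit a.
Proof.
have [[_ rL] r1 rM] := env_act_right_module ext_module.
have [eL e1 eM eg] := env_counit_hom g.
have eD := linD (V := k^o) eL; have eZ := linZ (V := k^o) eL.
move: a p; apply: env_ind => [c|x|a b Ea Eb|a b Ea Eb] p.
- by rewrite (linZ (rL p)) r1 eZ e1 /= /GRing.scale /= mulr1 mulrC.
- by rewrite env_act_gen eg mulr0.
- by rewrite (linD (rL p)) eD mulrDr -Ea -Eb.
- by rewrite rM Eb Ea eM mulrA.
Qed.

Lemma cocycle_ext_lin : linear cocycle_ext.
Proof.
have [[_ rL] _ _] := env_act_right_module ext_module.
by move=> c a b; rewrite /cocycle_ext rL.
Qed.

Lemma cocycle_ext_gen x : cocycle_ext (env_gen x) = w x.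
Proof.
have [aL _] := lie_act_bilin M.
by rewrite /cocycle_ext env_act_gen /= (lin0 (aL x)) scale1r add0r.
Qed.

Lemma cocycle_extM a b :
  cocycle_ext (a * b) = env_act M (cocycle_ext a) b + env_counit a *: cocycle_ext b.
Proof.
have [[rL _] _ rM] := env_act_right_module ext_module.
rewrite {1}/cocycle_ext rM.
(* Splitting (del(a), counit(a)) along L and (0, 1), then acting by b, yields the two terms of the
   twisted Leibniz rule. *)
have -> : env_act ext_module (0, 1) a = (cocycle_ext a, 0) + env_counit a *: (0, 1).
  rewrite [LHS]surjective_pairing ext_act_snd mul1r; congr pair.
    by rewrite /= scaler0 addr0.
  by rewrite /= add0r /GRing.scale /= mulr1.
by rewrite (linD (rL b)) (linZ (rL b)) ext_act_fst.
Qed.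

End CocycleExtension.

(** * Calculi and cocycles *)

Section FreeForms.
Variables (k : fieldType) (H : hopf_algebra k) (L : lmodType k).

Definition counit_form (x : tens H L) : L := tens_lift (fun a v => counit a *: v) x.

Lemma counit_form_lin : linear counit_form.
Proof. by rewrite /counit_form; lin. Qed.

Lemma counit_form_pure a v : counit_form (pure a v) = counit a *: v.
Proof. by rewrite /counit_form tens_lift_pure //; lin. Qed.

Lemma counit_form1 v : counit_form (pure 1 v) = v.
Proof. by rewrite counit_form_pure counit1 scale1r. Qed.

Lemma pure1_inj : injective (pure 1 : L -> tens H L).
Proof. exact: can_inj counit_form1. Qed.

(** Apply the counit to the middle factor of the coinvariance equation: a_1 (x) a_2 (x) v becomes a
    (x) v, and 1 (x) x becomes 1 (x) [counit_form x]. *)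
Lemma free_coinv x :
  tens_assoc (tens_map (@comul k H) id x) = pure 1 x -> x = pure 1 (counit_form x).
Proof.
have cL := counit_form_lin; have mE y : tens_map id counit_form y =
    tens_lift (fun a x => pure a (counit_form x)) y :> tens H L by [].
move/(congr1 (tens_map id counit_form)); rewrite tens_map_pure // => <-; symmetry.
move: x; apply: tens_lin_ext => [||a v]; try by lin.
rewrite tens_map_pure; try by lin.
rewrite (linear_tens_lift (f := fun y => tens_map id counit_form (tens_assoc (pure y v))));
  last by lin.
rewrite -[in RHS](comul_counitr a) (comp_tens_lift (fun b => pure b v)); last by lin.
apply: eq_tens_lift => b c.
by rewrite tens_assoc_pure tens_map_pure // counit_form_pure pureZr pureZl.
Qed.

End FreeForms.

(** Function extensionality identifies the operations, and proof irrelevance the axioms about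
    them. *)
Lemma lcov_calculus_ext (k : fieldType) (H : hopf_algebra k) (Om : lmodType k)
    (X X' : lcov_calculus H Om) :
  lact X =2 lact X' -> ract X =2 ract X' -> extd X =1 extd X' -> lcoact X =1 lcoact X' ->
  X = X'.
Proof.
have ext2 (A B C : Type) (f h : A -> B -> C) : f =2 h -> f = h.
  by move=> E; apply/funext => a; apply/funext.
case: X X' => [[l r d b dL dM] co c] [[l' r' d' b' dL' dM'] co' c'] /=.
move=> /ext2 E1 /ext2 E2 /funext E3 /funext E4; subst l' r' d' co'.
rewrite (Prop_irrelevance b b') (Prop_irrelevance dL dL') (Prop_irrelevance dM dM') in c c' *.
by rewrite (Prop_irrelevance c c').
Qed.

(** * The correspondence between standard calculi and cocycles *)

Section Realizations.
Variables (k : fieldType) (g : lieAlgebra k).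
Local Notation U := (env_hopf g).

Lemma standard_lact (L : lmodType k) (X : lcov_calculus U (tens U L)) a b v :
  standard_form X -> lact X a (pure b v) = pure (a * b) v.
Proof.
case=> E _ _; rewrite E tens_map_pure //.
by have mB := mul_bilin U; lin.
Qed.

Lemma standard_ract_gen (L : lmodType k) (X : lcov_calculus U (tens U L)) r v x :
  right_module r -> (forall y b, ract X y b = tens_op *%R r y (comul b)) ->
  ract X (pure 1 v) (env_gen x) = pure (env_gen x : U) v + pure 1 (r v (env_gen x)).
Proof.
move=> [rB r1 _] E; have mB := mul_bilin U; have [_ oR] := tens_op_bilin mB rB.
by rewrite E env_hopf_comul (linD (oR _)) !tens_op_pure // !mul1r r1.
Qed.

(** As x is primitive, (1 (x) v)x = x (x) v + 1 (x) v.x, whose first term is x(1 (x) v). *)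
Lemma standard_commutator (L : lmodType k) (X : lcov_calculus U (tens U L)) r v x :
  standard_form X -> right_module r ->
  (forall y b, ract X y b = tens_op *%R r y (comul b)) ->
  ract X (pure 1 v) (env_gen x) - lact X (env_gen x) (pure 1 v) = pure 1 (r v (env_gen x)).
Proof.
move=> sX rP E; rewrite (standard_ract_gen _ _ rP E) standard_lact // mulr1.
by rewrite addrC addKr.
Qed.

Lemma realizes_act (L : lmodType k) (M : right_lie_module g L) (w : cocycle M)
    (X : lcov_calculus U (tens U L)) : realizes X w ->
  exists r, [/\ right_module r, forall y b, ract X y b = tens_op *%R r y (comul b)
    & forall v x, r v (env_gen x) = lie_act M v x].
Proof.
move=> [sX cX _]; have [_ _ [r rP E]] := sX; exists r; split=> // v x.
by apply: (@pure1_inj _ U); rewrite -cX (standard_commutator _ _ sX rP E).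
Qed.

Lemma realizes_exists (L : lmodType k) (M : right_lie_module g L) (w : cocycle M) :
  exists X : lcov_calculus U (tens U L), realizes X w.
Proof.
have rP := env_act_right_module M; have dL := cocycle_ext_lin w.
have [X [sX rX dX]] := standard_calculus (H := U) rP dL (cocycle_extM w).
exists X; split=> // [v x|x].
  by rewrite (standard_commutator _ _ sX rP rX) env_act_gen.
rewrite dX env_hopf_comul (linD (tens_map_linear (@lin_id k U) dL)) !tens_map_pure //.
(* Since x is primitive, dx = x (x) del(1) + 1 (x) w(x); the first term must vanish. *)
have d1 : cocycle_ext w 1 = 0.
  have [_ e1 _ _] := env_counit_hom g; apply: (addrI (cocycle_ext w 1)).
  by rewrite addr0 -{3}(mulr1 1) cocycle_extM (rmod1 rP) e1 scale1r.
have [_ pR] := pure_bilin U L.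
by rewrite d1 (lin0 (pR _)) add0r cocycle_ext_gen.
Qed.

(** The standard form fixes the left action and the coaction; the commutators with g fix the right
    action, and the values on g fix d. *)
Lemma realizes_inj (L : lmodType k) (M : right_lie_module g L) (w : cocycle M)
    (X X' : lcov_calculus U (tens U L)) : realizes X w -> realizes X' w -> X = X'.
Proof.
move=> R R'; have [r [rP rX rg]] := realizes_act R; have [r' [rP' rX' rg']] := realizes_act R'.
have [[lX coX _] _ dX] := R; have [[lX' coX' _] _ dX'] := R'.
have El : lact X =2 lact X' by move=> a x; rewrite lX lX'.
have Er : ract X =2 ract X'.
  have Err : r = r'.
    apply/funext => v; apply/funext => a.
    by apply: (env_intertwine rP rP' (@lin_id k L)) => u x; rewrite rg rg'.
  by move=> x b; rewrite rX rX' Err.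
apply: lcov_calculus_ext => //; last by move=> x; rewrite coX coX'.
apply: (env_derivation_ext (calc_bimodule X)).
- exact: extd_linear.
- exact: extd_linear.
- exact: extd_leibniz.
- by move=> a b; rewrite extd_leibniz El Er.
- by move=> x; rewrite dX dX'.
Qed.

(** Covariance of d at the primitive x gives the coaction x (x) d1 + 1 (x) dx, and d1 = 0, so dx is
    coinvariant. *)
Lemma standard_extd_gen (L : lmodType k) (X : lcov_calculus U (tens U L)) x :
  standard_form X -> extd X (env_gen x) = pure 1 (counit_form (extd X (env_gen x))).
Proof.
move=> [_ coX _]; apply: free_coinv; rewrite -coX.
have [_ _ _ _ _ coD] := lcov_covariant X; have dL := extd_linear X.
have d1 := derivation1 (calc_bimodule X) (extd_leibniz X).
have [_ pR] := pure_bilin U (tens U L).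
rewrite coD env_hopf_comul (linD (tens_map_linear (@lin_id k U) dL)) !tens_map_pure //.
by rewrite d1 (lin0 (pR _)) add0r.
Qed.

Lemma realizes_cocycle (L : lmodType k) (X : lcov_calculus U (tens U L)) :
  standard_form X -> exists c : {M : right_lie_module g L & cocycle M}, realizes X (projT2 c).
Proof.
move=> sX; have [lX coX [r rP rX]] := sX; have [rB r1 rM] := rP; have [rL rR] := rB.
have gL := @env_gen_linear k g.
pose act v x := r v (env_gen x).
have aB : bilin act by exact: (bilin_compr (@lin_id k L) gL rB).
have aE v x y : act v [lie x, y] = act (act v x) y - act (act v y) x.
  by rewrite /act env_gen_bracket (linB (rR v)) !rM.
pose M := RightLieModule aB aE.
pose w x := counit_form (extd X (env_gen x)).
have dL := extd_linear X; have cL := @counit_form_lin k U L.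
have wL : linear w by rewrite /w; apply: (lin_comp gL (lin_comp dL cL)).
have dX x : extd X (env_gen x) = pure 1 (w x) by exact: standard_extd_gen.
have wE x y : w [lie x, y] = lie_act M (w x) y - lie_act M (w y) x.
  (* The Leibniz rule on xy - yx gives terms that regroup as (dx y - y dx) - (dy x - x dy), two
     commutators of invariant forms. *)
  apply: (@pure1_inj _ U); rewrite -dX env_gen_bracket (linB dL) !extd_leibniz !dX.
  have [_ pR] := pure_bilin U L; rewrite (linB (pR 1)) /= /act.
  rewrite -!(standard_commutator _ _ sX rP rX).
  by rewrite opprB [RHS]addrACA -opprD; congr (_ - _); apply: addrC.
exists (existT _ M (Cocycle wL wE)); split=> // v x.
exact: standard_commutator.
Qed.

Lemma realizes_cocycle_inj (L : lmodType k) (X : lcov_calculus U (tens U L))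
    (c c' : {M : right_lie_module g L & cocycle M}) :
  realizes X (projT2 c) -> realizes X (projT2 c') -> c = c'.
Proof.
case: c c' => [[a aB aE] [w wL wE]] [[a' aB' aE'] [w' wL' wE']] /= [_ cX dX] [_ cX' dX'].
have Ea : a = a'.
  by apply/funext => v; apply/funext => x; apply: (@pure1_inj _ U); rewrite -cX -cX'.
have Ew : w = w' by apply/funext => x; apply: (@pure1_inj _ U); rewrite -dX -dX'.
subst a' w'; rewrite (Prop_irrelevance aB' aB) (Prop_irrelevance aE' aE) in wE' cX' dX' *.
by rewrite (Prop_irrelevance wL' wL) (Prop_irrelevance wE' wE).
Qed.

Lemma inner_coboundary (L : lmodType k) (M : right_lie_module g L) (w : cocycle M)
    (X : lcov_calculus U (tens U L)) : realizes X w -> (inner X <-> coboundary w).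
Proof.
move=> R; have [r [rP rX rg]] := realizes_act R; have [sX cX dX] := R; have [lX _ _] := sX.
have [rB r1 rM] := rP; have [rL rR] := rB; have mB := mul_bilin U.
have [oL oR] := tens_op_bilin mB rB; have B := calc_bimodule X.
split=> [[th E]|[th E]].
  (* For theta = a (x) v, the form theta x - x theta is ax (x) v + a (x) v.x - xa (x) v; the counit
     kills ax and xa, leaving counit(a) v.x. *)
  exists (counit_form th) => x; apply: (@pure1_inj _ U); rewrite -dX standard_extd_gen // E.
  congr pure; rewrite rX lX env_hopf_comul -rg; move: th {E}.
  have cL := @counit_form_lin k U L; have aL := lie_act_bilin M.
  apply: tens_lin_ext => [||a v].
  - by rewrite /tens_map; lin.
  - by lin.
  rewrite (linD (oR _)) !tens_op_pure // tens_map_pure //; last by lin.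
  rewrite !(linD cL, linN cL) !counit_form_pure !counitM env_hopf_counit counit1.
  by rewrite mulr0 mul0r !scale0r add0r subr0 mulr1 (linZ (rL _)).
(* The commutator with this invariant form is a derivation, so comparing it with d on g suffices. *)
exists (pure 1 th).
have [[lB l1 lM] [raB ra1 raM] lr] := B.
apply: (env_derivation_ext B).
- exact: extd_linear.
- by lin.
- exact: extd_leibniz.
- move=> a b /=; rewrite raM lM.
  have [[_ lR] [raL _]] := (lB, raB).
  by rewrite (linB (raL _)) (linB (lR _)) lr addrA subrK.
by move=> x; rewrite dX cX E.
Qed.
End Realizations.

(** A colinear map sends the coinvariant 1 (x) v to a coinvariant, to which [free_coinv] applies. *)
Lemma colinear_form1 (k : fieldType) (H : hopf_algebra k) (L L' : lmodType k)
    (X : lcov_calculus H (tens H L)) (X' : lcov_calculus H (tens H L'))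
    (F : tens H L -> tens H L') v :
  standard_form X -> standard_form X' -> linear F ->
  (forall w, lcoact X' (F w) = tens_map id F (lcoact X w)) ->
  F (pure 1 v) = pure 1 (counit_form (F (pure 1 v))).
Proof.
move=> [_ coX _] [_ coX' _] FL E; apply: free_coinv; rewrite -coX' E coX.
by rewrite tens_map_pure ?comul1 ?tens_assoc_pure ?tens_map_pure //; lin.
Qed.

(** * Isomorphisms of calculi and of cocycles *)

Section Isomorphisms.
Variables (k : fieldType) (g : lieAlgebra k) (L L' : lmodType k).
Local Notation U := (env_hopf g).
Variables (M : right_lie_module g L) (M' : right_lie_module g L').
Variables (w : cocycle M) (w' : cocycle M').
Variables (X : lcov_calculus U (tens U L)) (X' : lcov_calculus U (tens U L')).
Hypotheses (R : realizes X w) (R' : realizes X' w').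

Lemma lcov_iso_cocycle : lcov_iso X X' -> cocycle_iso w w'.
Proof.
move=> [F [FL [[G FK GK] [Fl Fr Fd Fco]]]].
have [[sX cX dX] [sX' cX' dX']] := (R, R').
have GL : linear G by move=> c x y; rewrite -{1}(GK x) -{1}(GK y) -FL FK.
(* The inverse is colinear too, so both maps preserve invariant forms and restrict to mutually
   inverse maps between L and L'. *)
have Gco y : lcoact X (G y) = tens_map id G (lcoact X' y).
  rewrite -{2}(GK y) Fco tens_map_comp //.
  by rewrite -[LHS]tens_map_id; congr (tens_map _ _ _); apply/funext => z; rewrite FK.
have F1 v := colinear_form1 v sX sX' FL Fco; have G1 v := colinear_form1 v sX' sX GL Gco.
have cL := @counit_form_lin k U L'; have pB := pure_bilin U L.
exists (fun v => counit_form (F (pure 1 v))); split; first by lin.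
split.
  exists (fun v => counit_form (G (pure 1 v))) => v.
    by rewrite -F1 FK counit_form1.
  by rewrite -G1 GK counit_form1.
split=> [v x|x]; apply: (@pure1_inj _ U); rewrite -F1.
  by rewrite -cX (linB FL) Fr Fl F1 cX' counit_form1.
by rewrite -dX Fd dX'.
Qed.

Lemma cocycle_lcov_iso : cocycle_iso w w' -> lcov_iso X X'.
Proof.
move=> [f [fL [[h fK hK] [fa fw]]]].
have [r [rP rX rg]] := realizes_act R; have [r' [rP' rX' rg']] := realizes_act R'.
have [[sX cX dX] [sX' cX' dX']] := (R, R').
have [[lX coX _] [lX' coX' _]] := (sX, sX').
have hL : linear h by move=> c x y; rewrite -{1}(hK x) -{1}(hK y) -fL fK.
have fr v a : f (r v a) = r' (f v) a.
  by apply: (env_intertwine rP rP' fL) => u x; rewrite rg rg' fa.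
have mB := mul_bilin U; have rB := rmod_bilin rP; have rB' := rmod_bilin rP'.
have mL (a : U) : linear ( *%R a) by lin.
have FL : linear (tens_map id f : tens U L -> tens U L') by lin.
have Fl a x : tens_map id f (lact X a x) = lact X' a (tens_map id f x).
  by rewrite lX lX' !tens_map_comp.
have Fr x a : tens_map id f (ract X x a) = ract X' (tens_map id f x) a.
  rewrite rX rX' -[in RHS](tens_map_id (comul a)).
  by apply: tens_map_op.
exists (tens_map id f); split=> //; split.
  exists (tens_map id h) => x; rewrite tens_map_comp // -[RHS]tens_map_id;
    by congr (tens_map _ _ _); apply/funext => v; rewrite ?fK ?hK.
split=> // [|x].
  have dL := extd_linear X.
  (* The image of d under id (x) f and the differential of [X'] are derivations into the same
     bimodule that agree on g. *)
  apply: (env_derivation_ext (calc_bimodule X')).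
  - by lin.
  - exact: extd_linear.
  - by move=> a b; rewrite extd_leibniz (linD FL) Fl Fr.
  - exact: extd_leibniz.
  - by move=> x; rewrite dX dX' tens_map_pure // fw.
rewrite coX coX' -tens_assoc_map // !tens_map_comp //; try by lin.
by congr (tens_assoc (tens_map _ _ _)); apply/funext => a; rewrite tens_map_id.
Qed.

End Isomorphisms.

Theorem proposition2p10 (k : fieldType) (char_neq2 : 2%N \notin [pchar k])
  (g : lieAlgebra k) :
  [/\ forall (L : lmodType k) (M : right_lie_module g L) (w : cocycle M),
        exists! X : lcov_calculus (env_hopf g) (tens (env_hopf g) L), realizes X w,
      forall (L : lmodType k) (X : lcov_calculus (env_hopf g) (tens (env_hopf g) L)),
        standard_form X ->
        exists! c : {M : right_lie_module g L & cocycle M}, realizes X (projT2 c),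
      forall (Om : lmodType k) (X : lcov_calculus (env_hopf g) Om),
        exists (L : lmodType k) (X' : lcov_calculus (env_hopf g) (tens (env_hopf g) L)),
          standard_form X' /\ lcov_iso X X',
      forall (L L' : lmodType k) (M : right_lie_module g L) (M' : right_lie_module g L')
          (w : cocycle M) (w' : cocycle M')
          (X : lcov_calculus (env_hopf g) (tens (env_hopf g) L))
          (X' : lcov_calculus (env_hopf g) (tens (env_hopf g) L')),
        realizes X w -> realizes X' w' -> (lcov_iso X X' <-> cocycle_iso w w')
    & forall (L : lmodType k) (M : right_lie_module g L) (w : cocycle M)
          (X : lcov_calculus (env_hopf g) (tens (env_hopf g) L)),
        realizes X w -> (inner X <-> coboundary w)].
Proof.
split.
- move=> L M w; have [X R] := realizes_exists w; exists X; split=> // X'.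
  exact: realizes_inj.
- move=> L X sX; have [c R] := realizes_cocycle sX; exists c; split=> // c'.
  exact: realizes_cocycle_inj.
- move=> Om X; have [X' sX' iX'] := lcov_standard_form X.
  by exists (coinv_form X), X'.
- by move=> L L' M M' w w' X X' R R'; split; [apply: lcov_iso_cocycle | apply: cocycle_lcov_iso].
- by move=> L M w X; apply: inner_coboundary.
Qed.
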